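(* Let $G$ be an interpolation Banach lattice on $[0,1]$ with respect to the pair $(L^\infty,L^\infty(1/t))$. The following conditions are equivalent: (a) the operator $Rf(t):=f(t^{1/2})$ is bounded on $G$; (b) for every ordered pair $\vec A=(A_0,A_1)$ and for every $\theta\in(0,1)$, $1\le q\le\infty$, we have $\langle\vec A\rangle_G^K=\langle A_0,\vec A_{\theta,q}\rangle_G^K$; (c) for every ordered pair $\vec A=(A_0,A_1)$ there exist $\theta_1,\theta_2\in(0,1)$, $\theta_1\ne\theta_2$, $1\le q_1,q_2\le\infty$, such that $\langle A_0,\vec A_{\theta_1,q_1}\rangle_G^K=\langle A_0,\vec A_{\theta_2,q_2}\rangle_G^K$; (d) there exist $\theta_1,\theta_2\in(0,1)$, $\theta_1\ne\theta_2$, $1\le q_1,q_2\le\infty$, such that $$\langle L^1,(L^1,L^\infty)_{\theta_1,q_1}\rangle_G^K=\langle L^1,(L^1,L^\infty)_{\theta_2,q_2}\rangle_G^K .$$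
   Context: A Banach pair $\vec A=(A_0,A_1)$ consists of two Banach spaces continuously embedded in a common Hausdorff topological vector space; it is ordered if $A_1\subset A_0$ with embedding of norm at most $1$. $K(t,x;\vec A)=\inf\{\Vert a_0\Vert_{A_0}+t\Vert a_1\Vert_{A_1}: x=a_0+a_1,\ a_i\in A_i\}$. $L^p=L^p[0,1]$ (Lebesgue measure) and $\Vert f\Vert_{L^\infty(1/t)}=\Vert f(t)/t\Vert_{L^\infty}$. A Banach lattice $G$ of measurable functions on $[0,1]$ is an interpolation lattice with respect to $(L^\infty,L^\infty(1/t))$ if $L^\infty(1/t)\subset G\subset L^\infty$ continuously and every linear operator bounded on both $L^\infty$ and $L^\infty(1/t)$ is bounded on $G$. For a Banach pair $\vec B=(B_0,B_1)$, $\langle B_0,B_1\rangle_G^K=\langle\vec B\rangle_G^K=\{x\in B_0+B_1:\Vert K(\cdot,x;\vec B)\Vert_G<\infty\}$ with this norm (the $K$-functional is regarded as a function on $[0,1]$). $\vec A_{\theta,q}=(A_0,A_1)_{\theta,q}$ is the classical Lions–Peetre real interpolation space, with norm $\left(\int_0^\infty(s^{-\theta}K(s,x;\vec A))^q\frac{ds}{s}\right)^{1/q}$ (supremum if $q=\infty$). Equalities of spaces are understood with equivalence of norms. *)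

(* Defs.v *)
From HB Require Import structures.
From mathcomp Require Import all_boot all_order all_algebra.
From mathcomp Require Import all_classical all_reals all_analysis.

Set Implicit Arguments.
Unset Strict Implicit.
Unset Printing Implicit Defensive.
Import Order.TTheory GRing.Theory Num.Theory.
Import numFieldNormedType.Exports.
Local Open Scope classical_set_scope.
Local Open Scope ring_scope.

(** A normed space whose elements live in a vector space V is encoded by its
    norm, extended by +oo outside the space: N : V -> \bar R stands for the
    space {x | N x < +oo}. Spaces of classes of measurable functions on [0,1]
    are encoded in the same way over V := R -> R: a class is given by any
    representative, whose values outside [0,1] are ignored. *)

Section ExtendedNorms.
Context {R : realType}.
Implicit Types V : lmodType R.
Local Open Scope ereal_scope.

Definition embedded V (N M : V -> \bar R) : Prop :=
  exists C : R, forall x, N x < +oo -> M x <= C%:E * N x.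

Definition bounded_on V (N : V -> \bar R) (T : V -> V) : Prop :=
  exists C : R, forall x, N x < +oo -> N (T x) <= C%:E * N x.

Definition same_space V (N M : V -> \bar R) : Prop :=
  (forall x, N x < +oo <-> M x < +oo) /\
  exists2 c : R, (0 < c)%R &
    forall x, N x < +oo -> N x <= c%:E * M x /\ M x <= c%:E * N x.

Definition in_sum V (N0 N1 : V -> \bar R) (x : V) : Prop :=
  exists x0 x1, [/\ x = (x0 + x1)%R, N0 x0 < +oo & N1 x1 < +oo].

(** The conditions N0 x0 < +oo and N1 x1 < +oo are not redundant: at t = 0 the
    library has 0 * +oo = 0. *)
Definition Kfun V (N0 N1 : V -> \bar R) (t : R) (x : V) : \bar R :=
  ereal_inf [set y | exists x0 x1,
    [/\ x = (x0 + x1)%R, N0 x0 < +oo, N1 x1 < +oo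
      & y = N0 x0 + t%:E * N1 x1]].

(** Only meant for 1 <= q <= +oo; the last branch is the case q = +oo. *)
Definition real_interp V (N0 N1 : V -> \bar R) (theta : R) (q : \bar R)
    (x : V) : \bar R :=
  if q is r%:E then
    (\int[lebesgue_measure]_(s in `]0%R, +oo[)
      (((s `^ (- theta))%:E * Kfun N0 N1 s x) `^ r * (s^-1)%:E)) `^ r^-1
  else ereal_sup
    [set (s `^ (- theta))%:E * Kfun N0 N1 s x | s in `]0%R, +oo[].

(** On N0 + N1 the K-functional is finite for t in [0,1], so that [fine] loses
    no information there. *)
Definition Kspace (G : (R -> R) -> \bar R) V (N0 N1 : V -> \bar R) (x : V)
    : \bar R :=
  if `[< in_sum N0 N1 x >] then G (fun t => fine (Kfun N0 N1 t x)) else +oo.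

End ExtendedNorms.

Section BanachPairs.
Variable R : realType.

Record banach_pair := BanachPair {
  ambient : topologicalLmodType R;
  space0 : completeNormedModType R;
  space1 : completeNormedModType R;
  emb0 : {linear space0 -> ambient};
  emb1 : {linear space1 -> ambient};
  ambient_hausdorff : hausdorff_space ambient;
  emb0_inj : injective emb0;
  emb1_inj : injective emb1;
  emb0_cont : continuous emb0;
  emb1_cont : continuous emb1 }.

Variable A : banach_pair.

Definition norm0 (v : ambient A) : \bar R :=
  ereal_inf [set (`|a|%:E)%E | a in [set a : space0 A | emb0 A a = v]].

Definition norm1 (v : ambient A) : \bar R :=
  ereal_inf [set (`|a|%:E)%E | a in [set a : space1 A | emb1 A a = v]].

Definition ordered : Prop := forall a1 : space1 A,
  exists2 a0 : space0 A, emb0 A a0 = emb1 A a1 & `|a0| <= `|a1|.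

End BanachPairs.

Section FunctionSpaces.
Variable R : realType.
Implicit Types f g : R -> R.
Local Open Scope ereal_scope.

Definition I01 : set R := `[0%R, 1%R].

Definition Lp (p : \bar R) f : \bar R :=
  if `[< measurable_fun I01 f >]
  then Lnorm (@lebesgue_measure R) p (EFin \o (f \_ I01)) else +oo.

(** The weighted space L^oo(1/t). *)
Definition Linfw f : \bar R := Lp +oo (fun t => f t / t)%R.

Record banach_lattice (G : (R -> R) -> \bar R) : Prop := {
  lattice_ge0 : forall f, 0 <= G f;
  lattice_measurable : forall f, G f < +oo -> measurable_fun I01 f;
  lattice_eq0 : forall f, G f = 0 ->
    {ae (@lebesgue_measure R), forall t, I01 t -> f t = 0%R};
  lattice_scale : forall (a : R) f, G (a *: f)%R = `|a|%:E * G f;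
  lattice_triangle : forall f g, G (f + g)%R <= G f + G g;
  lattice_le : forall f g, measurable_fun I01 f ->
    {ae (@lebesgue_measure R), forall t, I01 t -> (`|f t| <= `|g t|)%R} ->
    G f <= G g;
  lattice_complete : forall u : nat -> R -> R,
    (forall n, G (u n) < +oo) ->
    (forall e : R, (0 < e)%R -> exists n0, forall m n,
      (n0 <= m)%N -> (n0 <= n)%N -> G (u m - u n)%R < e%:E) ->
    exists2 f, G f < +oo & G (u n - f)%R @[n --> \oo] --> 0 }.

(** T is only required to be a linear operator on classes of functions in
    L^oo; its values elsewhere are irrelevant, since L^oo contains G. *)
Definition linear_on_Linf (T : (R -> R) -> R -> R) : Prop :=
  forall (a : R) f g, Lp +oo f < +oo -> Lp +oo g < +oo ->
    {ae (@lebesgue_measure R), forall t, I01 t ->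
      T (a *: f + g)%R t = (a * T f t + T g t)%R}.

Record interpolation_lattice (G : (R -> R) -> \bar R) : Prop := {
  interpolation_banach : banach_lattice G;
  interpolation_embw : embedded Linfw G;
  interpolation_emb : embedded G (Lp +oo);
  interpolation_bounded : forall T : (R -> R) -> R -> R,
    linear_on_Linf T -> bounded_on (Lp +oo) T -> bounded_on Linfw T ->
    bounded_on G T }.

End FunctionSpaces.

(* Main.v *)
(** Let [K] be the K-functional of an ordered pair [(A0, A1)] and [K_theta] that
    of [(A0, A_theta,q)].

    Up to constants [K(t^(1/theta)) <= K_theta(t) <= K(t)] on [0, 1]. If [R] is
    bounded on [G] then so are its iterates, hence the two sides have equivalent
    norms in [G], and (b) follows; only the two norms of the pair matter here.

    Conversely let [theta1 < alpha < theta2] and let [phi] be quasi-concave. If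
    [K(s, x)] is comparable to [phi(s^alpha)], then [K_theta1(t, x)] is at most a
    multiple of [phi(t)], while [K_theta2(t, x)] is at least a multiple of
    [phi(t^d)] for [d = alpha / theta2 < 1]. So equality of the two spaces bounds
    [phi(t^d)] by [phi] in [G], and iterating bounds [R] on quasi-concave functions.
    This extends to [G] because every [f] in [G] has a quasi-concave majorant of
    comparable norm: averages over dyadic intervals give an operator, depending on
    [f], which maps [|f|] to a multiple of such a majorant, and the constant is
    uniform because otherwise a sum of counterexamples would have no majorant.

    The pair (L^1, L^oo) realizes every quasi-concave function vanishing at 0, and
    if [G] contains another one then [G] = L^oo. From (c) it is simpler to first
    obtain (a), from a pair of weighted spaces of bounded functions, and to deduce
    (d) from (a) as (b) was. *)

Require Import Defs.
From HB Require Import structures.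
From mathcomp Require Import all_boot all_order all_algebra.
From mathcomp Require Import all_classical all_reals all_analysis.
From mathcomp Require Import measurable_realfun ess_sup_inf ring lra.

Set Implicit Arguments.
Unset Strict Implicit.
Unset Printing Implicit Defensive.
Import Order.TTheory GRing.Theory Num.Theory.
Import numFieldNormedType.Exports.
Local Open Scope classical_set_scope.
Local Open Scope ring_scope.

(** [G] sees only [t] in [[0, 1]], whereas the norm of [A_theta,q] integrates over the whole
    half-line. The ordering removes this mismatch: [K(1, x)] is at least the norm of [x] in [A0],
    and no [K(t, x)] exceeds that norm. No full Holmstedt formula is needed. The lower bound for
    [K_theta] follows from [K(s, y) <= 4 s^theta N_theta(y)], valid for every [q]. The upper bound
    is used only for [K(s, x)] of size [phi(s^alpha)] with [theta < alpha]. This gap makes the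
    weighted K-functional of a cut piece decay like a power on both sides of the cut point and of 1,
    so two power peaks bound its norm, with a constant independent of where the cut is made. The
    obstacle in the majorants is that forming a quasi-concave hull is not linear, while the
    interpolation property speaks of linear operators only. The hull is therefore linearized at a
    given [f], by choosing for each dyadic interval an index that nearly attains the supremum. The
    operator norm then depends on [f], and the completeness of [G] has to restore uniformity. *)

(** * K-functionals of ordered pairs of norms *)

Section Kfunctional.
Context {R : realType} {V : lmodType R}.
Implicit Types (x y : V) (t : R).
Local Open Scope ereal_scope.

(** The common interface of the two norms of an ordered Banach pair, on its ambient space, and of
    [Lp 1] and [Lp +oo] on functions. By [onorm_le] the sum of the two spaces is the first one. *)
Record ordered_norms (N0 N1 : V -> \bar R) : Prop := {
  onorm_ge0 : forall x, 0 <= N0 x;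
  onormD : forall x y, N0 (x + y)%R <= N0 x + N0 y;
  onormN : forall x, N0 (- x)%R = N0 x;
  onorm1_0 : N1 0%R = 0;
  onorm_le : forall x, N0 x <= N1 x }.

Lemma Kfun_le_dec (N0 N1 : V -> \bar R) t x x0 x1 : x = (x0 + x1)%R ->
  N0 x0 < +oo -> N1 x1 < +oo -> Kfun N0 N1 t x <= N0 x0 + t%:E * N1 x1.
Proof. by move=> xE N0x0 N1x1; apply: ereal_inf_lbound; exists x0, x1. Qed.

Lemma Kfun_ge (N0 N1 : V -> \bar R) t x (y : \bar R) :
  (forall x0 x1, x = (x0 + x1)%R -> N0 x0 < +oo -> N1 x1 < +oo ->
     y <= N0 x0 + t%:E * N1 x1) -> y <= Kfun N0 N1 t x.
Proof.
by move=> h; apply: le_ereal_inf_tmp => _ [x0 [x1 [xE N0x0 N1x1 ->]]]; exact: h.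
Qed.

Lemma Kfun_lt_dec (N0 N1 : V -> \bar R) t x (y : \bar R) : Kfun N0 N1 t x < y ->
  exists x0 x1, [/\ x = (x0 + x1)%R, N0 x0 < +oo, N1 x1 < +oo &
    N0 x0 + t%:E * N1 x1 < y].
Proof.
move=> /ereal_inf_lt[_ [x0 [x1 [xE N0x0 N1x1 ->]]] lty].
by exists x0, x1.
Qed.

Lemma Kfun_ge0 (N0 N1 : V -> \bar R) t x : (forall x, 0 <= N0 x) -> (forall x, 0 <= N1 x) ->
  (0 <= t)%R -> 0 <= Kfun N0 N1 t x.
Proof.
move=> N00 N10 t0; apply: Kfun_ge => x0 x1 _ _ _.
by rewrite adde_ge0// mule_ge0.
Qed.

Lemma le_Kfun (N0 N1 : V -> \bar R) s t x : (forall x, 0 <= N1 x) -> (s <= t)%R ->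
  Kfun N0 N1 s x <= Kfun N0 N1 t x.
Proof.
move=> N10 st; apply: Kfun_ge => x0 x1 xE N0x0 N1x1.
apply: (le_trans (Kfun_le_dec _ xE N0x0 N1x1)).
by rewrite leeD2l// lee_wpmul2r.
Qed.

Lemma Kfun_notin_sum (N0 N1 : V -> \bar R) t x : ~ in_sum N0 N1 x -> Kfun N0 N1 t x = +oo.
Proof.
move=> nx; apply/eqP; rewrite -leye_eq; apply: Kfun_ge => x0 x1 xE h0 h1.
by exfalso; apply: nx; exists x0, x1.
Qed.

Lemma Kfun_le0 (N0 N1 : V -> \bar R) t x : N1 0%R = 0 -> Kfun N0 N1 t x <= N0 x.
Proof.
move=> N10; have [N0x|] := ltP (N0 x) +oo; last first.
  by rewrite leye_eq => /eqP ->; rewrite leey.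
by rewrite (le_trans (@Kfun_le_dec _ _ t x x 0%R _ _ _)) ?addr0 ?N10// mule0 adde0.
Qed.

Lemma Kfun_le1 (N0 N1 : V -> \bar R) t x : N0 0%R = 0 -> (0 < t)%R -> Kfun N0 N1 t x <= t%:E * N1 x.
Proof.
move=> N00 t0; have [N1x|] := ltP (N1 x) +oo; last first.
  by rewrite leye_eq => /eqP ->; rewrite gt0_muley ?lte_fin// leey.
by rewrite (le_trans (@Kfun_le_dec _ _ t x 0%R x _ _ _)) ?add0r ?N00// add0e.
Qed.

Section ordered.
Variables N0 N1 : V -> \bar R.
Hypothesis hN : ordered_norms N0 N1.

Lemma onorm1_ge0 x : 0 <= N1 x.
Proof. exact: le_trans (onorm_ge0 hN x) (onorm_le hN x). Qed.

Lemma onorm0_0 : N0 0%R = 0.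
Proof.
apply/eqP; rewrite eq_le (onorm_ge0 hN) andbT -(onorm1_0 hN).
exact: onorm_le.
Qed.

Lemma in_sum_ordered x : in_sum N0 N1 x <-> N0 x < +oo.
Proof.
split=> [[x0 [x1 [-> h0 h1]]]|N0x].
  apply: (le_lt_trans (onormD hN _ _)); rewrite lte_add_pinfty//.
  exact: le_lt_trans (onorm_le hN _) h1.
by exists x, 0%R; rewrite addr0 N0x (onorm1_0 hN).
Qed.

Lemma Kfun_ordered_ge0 t x : (0 <= t)%R -> 0 <= Kfun N0 N1 t x.
Proof. exact: Kfun_ge0 (onorm_ge0 hN) onorm1_ge0. Qed.

Lemma Kfun_lty t x : N0 x < +oo -> Kfun N0 N1 t x < +oo.
Proof. exact: le_lt_trans (Kfun_le0 _ _ _ (onorm1_0 hN)). Qed.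

Lemma Kfun_fin_num t x : (0 <= t)%R -> N0 x < +oo ->
  Kfun N0 N1 t x \is a fin_num.
Proof. by move=> t0 h; rewrite ge0_fin_numE ?Kfun_lty ?Kfun_ordered_ge0. Qed.

Lemma Kfun1_ge x : N0 x <= Kfun N0 N1 1 x.
Proof.
apply: Kfun_ge => x0 x1 -> _ _; rewrite mul1e.
by apply: (le_trans (onormD hN _ _)); rewrite leeD2l ?(onorm_le hN).
Qed.

(** A decomposition [x = y0 + y1] gives [x1 = (y0 - x0) + y1]: splitting off a piece costs at most
    its first norm, uniformly in [t]. *)
Lemma Kfun_sub_le t x x0 x1 : x = (x0 + x1)%R -> N0 x0 < +oo ->
  Kfun N0 N1 t x1 <= Kfun N0 N1 t x + N0 x0.
Proof.
move=> xE h0; have f0 : N0 x0 \is a fin_num by rewrite ge0_fin_numE ?(onorm_ge0 hN).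
rewrite -leeBlDr//; apply: Kfun_ge => y0 y1 yE hy0 hy1; rewrite leeBlDr//.
have D0 : N0 (y0 - x0)%R <= N0 y0 + N0 x0.
  by rewrite (le_trans (onormD hN _ _))// (onormN hN).
apply: (@le_trans _ _ (N0 (y0 - x0)%R + t%:E * N1 y1)).
  apply: Kfun_le_dec => //; last by rewrite (le_lt_trans D0)// lte_add_pinfty.
  by rewrite addrAC -yE xE addrAC subrr add0r.
by rewrite addeAC leeD2r.
Qed.

End ordered.
End Kfunctional.

(** * The real interpolation norm *)

Section kernel.
Context {R : realType}.
Implicit Types (p a s : R).

(* The derivative of [s^p / (s^p + a^p)]; its integral over [0, +oo[ is therefore 1. *)
Definition kern p a s : R := p * s `^ (p - 1) * a `^ p / (s `^ p + a `^ p) ^+ 2.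

Lemma kern_ge0 p a s : 0 < p -> 0 <= kern p a s.
Proof.
by move=> p0; rewrite /kern !mulr_ge0 ?invr_ge0 ?sqr_ge0 ?powR_ge0// ltW.
Qed.

Let F p a s : R := s `^ p / (s `^ p + a `^ p).

Lemma is_derive_kern p a s : 0 < a -> 0 < s ->
  is_derive s 1 (F p a) (kern p a s).
Proof.
move=> a0 s0.
have sa : s `^ p + a `^ p != 0 by rewrite gt_eqF// addr_gt0 ?powR_gt0.
have h1 := is_derive1_powR p s0.
pose g (s : R) : R := s `^ p + a `^ p.
have h2 : is_derive s (1:R) g (p * s `^ (p - 1) + 0).
  exact: (@is_deriveD _ _ _ (@powR R ^~ p) (cst (a `^ p)) _ _ _ _ h1).
have dg : derivable g s 1 by case: h2.
have h3 : is_derive s (1:R) (fun y => (g y)^-1) (- (g s) ^- 2 *: (p * s `^ (p - 1) + 0)).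
  split; first exact: derivableV.
  by rewrite deriveV//; case: h2 => _ ->.
apply: (is_derive_eq (is_deriveM h1 h3)) => /=.
rewrite /kern /GRing.scale/= addr0 /g; move: sa.
set x := s `^ p; set y := a `^ p; set z := s `^ (p - 1) => sa.
by field.
Qed.

Lemma powR_continuous p s : 0 < s -> {for s, continuous (@powR R ^~ p : R -> R)}.
Proof.
move=> s0; apply: differentiable_continuous; apply/derivable1_diffP.
by apply: derivable_powR; rewrite in_itv/= s0.
Qed.

Lemma kern_continuous p a s : 0 < a -> 0 < s -> {for s, continuous (kern p a)}.
Proof.
move=> a0 s0; rewrite /kern.
have sa : s `^ p + a `^ p != 0 by rewrite gt_eqF// addr_gt0 ?powR_gt0.
apply: cvgM.
  apply: cvgM; last exact: cvg_cst.
  by apply: cvgM; [exact: cvg_cst|exact: powR_continuous].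
apply: cvgV; first by rewrite sqrf_eq0.
have h : (s0 `^ p + a `^ p @[s0 --> s] --> s `^ p + a `^ p)%classic.
  by apply: cvgD; [exact: powR_continuous|exact: cvg_cst].
by apply: cvgM; exact: h.
Qed.

Local Open Scope ereal_scope.
Notation mu := (@lebesgue_measure R).

Lemma integral_kern_itv p a c d : (0 < a)%R -> (0 < c < d)%R ->
  \int[mu]_(s in `[c, d]) (kern p a s)%:E <= 1.
Proof.
move=> a0 /andP[c0 cd].
have FF s : (0 < s)%R -> {for s, continuous (F p a)}.
  move=> s0; apply: differentiable_continuous; apply/derivable1_diffP.
  exact: (@ex_derive _ _ _ _ _ _ _ (is_derive_kern p a0 s0)).
rewrite (@continuous_FTC2 _ _ (F p a))//.
- rewrite -EFinB lee_fin /F lerBlDr.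
  apply: (@le_trans _ _ 1%R).
    by rewrite ler_pdivrMr ?addr_gt0 ?powR_gt0 ?(lt_trans c0 cd)// mul1r lerDl powR_ge0.
  by rewrite lerDl divr_ge0 ?addr_ge0 ?powR_ge0.
- apply: continuous_in_subspaceT => s; rewrite inE/= in_itv/= => /andP[cs _].
  by apply: kern_continuous => //; exact: lt_le_trans cs.
- split.
  + move=> s; rewrite in_itv/= => /andP[cs _].
    exact: (@ex_derive _ _ _ _ _ _ _ (is_derive_kern p a0 (lt_trans c0 cs))).
  + by apply: cvg_at_right_filter; exact: FF.
  + by apply: cvg_at_left_filter; apply: FF; exact: lt_trans cd.
- move=> s; rewrite in_itv/= => /andP[cs _]; rewrite derive1E.
  exact: (@derive_val _ _ _ _ _ _ _ (is_derive_kern p a0 (lt_trans c0 cs))).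
Qed.

Lemma measurable_kern p a : (0 < a)%R ->
  measurable_fun (`]0%R, +oo[%classic : set R) (kern p a).
Proof.
move=> a0; apply: open_continuous_measurable_fun; first exact: interval_open.
move=> s; rewrite inE/= in_itv/= andbT => s0.
exact: kern_continuous.
Qed.

Lemma integral_kern p a : (0 < p)%R -> (0 < a)%R ->
  \int[mu]_(s in `]0%R, +oo[) (kern p a s)%:E <= 1.
Proof.
move=> p0 a0.
(* Compact intervals exhausting the half-line; the shift by 2 keeps the left end strictly below the
   right end already for [n = 0]. *)
pose D (n : nat) : set R := `[(n.+2%:R)^-1%R, n.+2%:R]%classic.
have i0 n : (0 < n.+2%:R^-1 :> R)%R by rewrite invr_gt0 ltr0n.
have Dlt n : (n.+2%:R^-1 < n.+2%:R :> R)%R.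
  apply: (@lt_trans _ _ (1:R)%R); last by rewrite ltr1n.
  by rewrite invf_lt1 ?ltr0n ?ltr1n.
have -> : (`]0%R, +oo[%classic : set R) = \bigcup_n D n.
  apply/seteqP; split=> s /=; rewrite /D/= ?in_itv/= ?andbT.
    move=> s0; have [n /ltW ns] : exists n, (Num.max s s^-1 < n%:R)%R.
      by exists (Num.truncn (Num.max s s^-1)%R).+1; exact: truncnS_gt.
    move: ns; rewrite ge_max => /andP[sn isn].
    exists n => //=; rewrite in_itv/=.
    have nn : (n%:R <= n.+2%:R :> R)%R by rewrite ler_nat -addn2 leq_addr.
    rewrite (le_trans sn)// andbT invf_ple ?posrE ?ltr0n//.
    exact: le_trans nn.
  by move=> [n _] /=; rewrite in_itv/= => /andP[+ _]; apply: lt_le_trans; rewrite invr_gt0 ltr0n.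
have Dsub n : D n `<=` `]0%R, +oo[%classic.
  move=> s; rewrite /D/= !in_itv/= andbT => /andP[+ _]; apply: lt_le_trans.
  by rewrite invr_gt0 ltr0n.
have nD : nondecreasing_seq D.
  move=> m n mn; rewrite subsetEset => s; rewrite /D/= !in_itv/= => /andP[ms sm].
  rewrite (le_trans _ ms) ?(le_trans sm)//; first by rewrite ler_nat.
  by rewrite lef_pV2 ?posrE ?ltr0n// ler_nat.
have mD n : measurable (D n) by exact: measurable_itv.
have mf n : measurable_fun (D n) (EFin \o kern p a).
  by apply/measurable_EFinP; apply: measurable_funS (measurable_kern p a0).
have f0 n (s : R) : D n s -> 0 <= (EFin \o kern p a) s.
  by move=> _; rewrite lee_fin kern_ge0.
have := ge0_nondecreasing_set_cvg_integral (mu := @lebesgue_measure R) nD mD mf f0.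
move=> /cvg_lim <-//.
apply: lime_le; last first.
  by apply: nearW => n; apply: integral_kern_itv => //; rewrite i0 Dlt.
apply: ereal_nondecreasing_is_cvgn.
exact: ge0_nondecreasing_set_nondecreasing_integral.
Qed.

End kernel.

Lemma powR_mulVN {R : realType} (s p : R) : 0 < s -> s `^ p * s `^ (- p) = 1.
Proof. by move=> s0; rewrite powRN mulfV// gt_eqF// powR_gt0. Qed.

Lemma powR_div {R : realType} (p s a : R) : 0 < s -> 0 < a ->
  (s / a) `^ p = s `^ p / a `^ p.
Proof.
move=> s0 a0; rewrite powRM ?invr_ge0 ?ltW//; congr (_ * _).
apply: (mulIf (x := a `^ p)); first by rewrite gt_eqF// powR_gt0.
by rewrite -powRM ?invr_ge0 ?ltW// !mulVf ?gt_eqF ?powR_gt0// powR1.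
Qed.

Lemma powR_min {R : realType} (r u v : R) : 0 <= r -> 0 <= u -> 0 <= v ->
  Num.min u v `^ r = Num.min (u `^ r) (v `^ r).
Proof.
move=> r0 u0 v0; case: (leP u v) => [uv|/ltW vu].
  by rewrite min_l// ge0_ler_powR.
by rewrite min_r// ge0_ler_powR.
Qed.

Section interpolation_norm.
Context {R : realType} {V : lmodType R}.
Variables N0 N1 : V -> \bar R.
Hypothesis hN : ordered_norms N0 N1.
Local Open Scope ereal_scope.
Notation mu := (@lebesgue_measure R).
Notation Rp := (`]0%R, +oo[%classic : set R).

Lemma measurable_Kfun x : measurable_fun Rp (fun s => Kfun N0 N1 s x).
Proof.
have [h|h] := ltP (N0 x) +oo; last first.
  have n : ~ in_sum N0 N1 x by rewrite (in_sum_ordered hN) => /lt_le_trans/(_ h); rewrite ltxx.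
  rewrite (_ : (fun s => _) = cst +oo); last by apply/funext => s; rewrite Kfun_notin_sum.
  exact: measurable_cst.
(* Frozen at its value at 0 for negative [s], the K-functional becomes monotone on the whole line,
   hence measurable. *)
pose g (s : R) := fine (Kfun N0 N1 (Num.max 0 s)%R x).
apply: (eq_measurable_fun (EFin \o g)).
  move=> s; rewrite inE/= in_itv/= andbT => s0.
  by rewrite /g max_r ?ltW// fineK// (Kfun_fin_num hN)// ltW.
apply/measurable_EFinP; apply: nondecreasing_measurable => // s t st.
rewrite /g fine_le ?(Kfun_fin_num hN) ?le_max ?lexx//.
by apply: le_Kfun; [exact: (onorm1_ge0 hN)|rewrite ge_max !le_max lexx st/= orbT].
Qed.

Let integrand theta r x (s : R) :=
  ((s `^ (- theta))%:E * Kfun N0 N1 s x) `^ r * (s^-1)%:E.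

Lemma measurable_integrand theta r x : measurable_fun Rp (integrand theta r x).
Proof.
apply: emeasurable_funM; last first.
  apply/measurable_EFinP; apply: open_continuous_measurable_fun.
    exact: interval_open.
  move=> s; rewrite inE/= in_itv/= andbT => s0.
  by apply: inv_continuous; rewrite gt_eqF.
apply: (@measurableT_comp _ _ _ _ _ _ (fun y : \bar R => y `^ r)).
  exact: measurable_poweR.
apply: emeasurable_funM; last exact: measurable_Kfun.
by apply/measurable_EFinP; apply: measurable_funTS; exact: measurable_powR.
Qed.

(** Since the K-functional increases, on []s, 2s]] the integrand is at least [b^r / (2s)] with
    [b = (2s)^(-theta) K(s, x)]. The interval has length [s], so the integral is at least [b^r / 2].
    The 4 absorbs [2^theta] and [2^(1/r)], and so serves all [theta] and [q]. *)
Lemma Kfun_le_interp theta q s x : (0 < theta < 1)%R -> 1 <= q -> (0 < s)%R ->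
  Kfun N0 N1 s x <= (4 * s `^ theta)%:E * real_interp N0 N1 theta q x.
Proof.
move=> /andP[th0 th1] q1 s0.
have K0 (t : R) : (0 < t)%R -> 0 <= Kfun N0 N1 t x.
  by move=> t0; rewrite (Kfun_ordered_ge0 hN)// ltW.
have p0 t : (0 < t)%R -> 0 <= (t `^ (- theta))%:E * Kfun N0 N1 t x.
  by move=> t0; rewrite mule_ge0 ?K0// lee_fin powR_ge0.
case: q q1 => [r|_|//]; last first.
  apply: (@le_trans _ _ ((4 * s `^ theta)%:E * ((s `^ (- theta))%:E * Kfun N0 N1 s x))).
    rewrite muleA -EFinM -mulrA powR_mulVN// mulr1.
    by rewrite -[leLHS]mul1e lee_wpmul2r ?K0// lee_fin ler1n.
  rewrite lee_wpmul2l ?lee_fin ?mulr_ge0 ?powR_ge0//.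
  by apply: ereal_sup_ubound; exists s => //=; rewrite in_itv/= s0.
rewrite lee_fin => r1; have r0 : (0 < r)%R := lt_le_trans ltr01 r1.
have s20 : (0 < 2 * s)%R by rewrite mulr_gt0.
have I0 t : (0 < t)%R -> 0 <= integrand theta r x t.
  by move=> t0; rewrite /integrand mule_ge0 ?poweR_ge0// lee_fin invr_ge0 ltW.
pose B : set R := `]s, (2 * s)%R]%classic.
have mB : measurable B by exact: measurable_itv.
have BRp : B `<=` Rp.
  by move=> t; rewrite /B/= !in_itv/= andbT => /andP[+ _]; exact: lt_trans.
pose b := ((2 * s) `^ (- theta))%:E * Kfun N0 N1 s x.
have b0 : 0 <= b by rewrite mule_ge0 ?K0// lee_fin powR_ge0.
have muB : mu B = s%:E.
  by rewrite lebesgue_measure_itv/= lte_fin -EFinD mulr_natl mulr2n ltrDl s0 addrK.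
have Ib : b `^ r * (2^-1)%:E <= \int[mu]_(t in Rp) integrand theta r x t.
  apply: (@le_trans _ _ (\int[mu]_(t in B) integrand theta r x t)); last first.
    apply: ge0_subset_integral => //; first exact: measurable_integrand.
    by move=> t /=; rewrite in_itv/= andbT; exact: I0.
  apply: (@le_trans _ _ (\int[mu]_(t in B) (b `^ r * ((2 * s)^-1)%:E))).
    rewrite integral_cst//= muB -muleA -EFinM lee_wpmul2l ?poweR_ge0// lee_fin.
    by rewrite invfM -mulrA mulVf ?gt_eqF// mulr1.
  apply: ge0_le_integral => //.
  - by move=> t _; rewrite mule_ge0 ?poweR_ge0// lee_fin invr_ge0 ltW.
  - by apply: measurable_funS (measurable_integrand theta r x).
  - move=> t; rewrite /B/= in_itv/= => /andP[st ts]; have t0 := lt_trans s0 st.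
    rewrite /integrand lee_pmul ?poweR_ge0 ?lee_fin ?invr_ge0 ?(ltW s20)//; last first.
      by rewrite lef_pV2 ?posrE.
    apply: gt0_ler_poweR; rewrite ?(ltW r0)// ?in_itv/= ?leey ?andbT ?b0 ?p0//.
    rewrite /b lee_pmul ?K0// ?lee_fin ?powR_ge0//.
      by rewrite !powRN lef_pV2 ?posrE ?powR_gt0// ge0_ler_powR ?nnegrE ?(ltW th0) ?(ltW t0) ?(ltW s20).
    by apply: le_Kfun; [exact: (onorm1_ge0 hN)|exact: ltW].
rewrite /real_interp.
apply: (@le_trans _ _ ((4 * s `^ theta)%:E * (b `^ r * (2^-1)%:E) `^ r^-1)); last first.
  rewrite lee_wpmul2l ?lee_fin ?mulr_ge0 ?powR_ge0//.
  apply: gt0_ler_poweR; rewrite ?invr_ge0 ?(ltW r0)// ?in_itv/= ?leey ?andbT//.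
    by rewrite mule_ge0 ?poweR_ge0// lee_fin.
  by apply: integral_ge0 => t /=; rewrite in_itv/= andbT; exact: I0.
rewrite poweRM ?poweR_ge0 ?lee_fin// -poweRrM mulfV ?gt_eqF// poweRe1//.
rewrite poweR_EFin muleC -muleA -EFinM /b muleAC -EFinM.
rewrite -[leLHS]mul1e lee_wpmul2r ?K0// lee_fin.
rewrite powRM ?(ltW s0)// mulrC.
have h1 : (2^-1 <= (2:R) `^ (- theta))%R.
  rewrite -[leLHS]powR_inv1//; apply: ler_powR; rewrite ?ler1n// lerN2 ltW//.
have h2 : (2^-1 <= (2^-1:R) `^ r^-1)%R.
  apply: ger1_powR; last by rewrite invf_le1.
  by rewrite invr_gt0 ltr0n/= invf_le1 ?ltr0n// ler1n.
have -> : (2^-1 `^ r^-1 * (4 * s `^ theta) * (2 `^ (- theta) * s `^ (- theta)) =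
  4 * (2^-1 `^ r^-1 * 2 `^ (- theta)) * (s `^ theta * s `^ (- theta)))%R by ring.
rewrite powR_mulVN// mulr1.
have h3 : (2^-1 * 2^-1 <= (2^-1:R) `^ r^-1 * 2 `^ (- theta))%R by apply: ler_pM.
by rewrite -ler_pdivrMl// mulr1 (le_trans _ h3)// -invfM -natrM.
Qed.

(** With [u = s / a] this is [min(u^e, u^-e)], a peak of height 1 at [a] with power decay towards 0
    and infinity. *)
Definition bump e a s : R := Num.min ((s / a) `^ e)%R ((s / a) `^ (- e))%R.

(** With [w = (s / a)^(e r)] the kernel is [e r w / ((1 + w)^2 s)] and the bump to the power [r] is
    [min(w, 1/w)]. The claim becomes [min(w, 1/w) (1 + w)^2 <= 4 w], checked on each side of
    [w = 1]. *)
Lemma bump_kern e r a s : (0 < e)%R -> (0 < r)%R -> (0 < a)%R -> (0 < s)%R ->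
  ((bump e a s) `^ r / s <= 4 / (e * r) * kern (e * r) a s)%R.
Proof.
move=> e0 r0 a0 s0.
pose w := ((s / a) `^ (e * r))%R.
have w0 : (0 < w)%R by rewrite powR_gt0 ?divr_gt0.
have kE : kern (e * r) a s = (e * r * (w / (1 + w) ^+ 2) / s)%R.
  rewrite /kern /w powRB; last by rewrite (gt_eqF s0) implybT.
  rewrite powRr1 ?(ltW s0)// (powR_div _ s0 a0).
  have A := powR_gt0 (e * r) a0; have S := powR_gt0 (e * r) s0.
  move: (a `^ _)%R (s `^ _)%R A S => A S A0 S0.
  field; rewrite !gt_eqF//= ?addr_gt0// ?mulr_gt0//.
have -> : ((bump e a s) `^ r = Num.min w w^-1)%R.
  rewrite /bump /w -powRN -mulNr !powRrM.
  by rewrite powR_min ?powR_ge0// ltW.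
rewrite kE (_ : 4 / _ * _ = 4 * (w / (1 + w) ^+ 2) / s)%R; last first.
  by field; rewrite !gt_eqF ?addr_gt0.
rewrite ler_pM2r ?invr_gt0// mulrA ler_pdivlMr ?exprn_gt0 ?addr_gt0//.
have [h|h] := leP w 1%R.
  apply: (@le_trans _ _ (w * (1 + w) ^+ 2)%R).
    by rewrite ler_pM2r ?exprn_gt0 ?addr_gt0// ge_min lexx.
  by rewrite mulrC ler_pM2r//; nra.
apply: (@le_trans _ _ (w^-1 * (1 + w) ^+ 2)%R).
  by rewrite ler_pM2r ?exprn_gt0 ?addr_gt0// ge_min lexx orbT.
rewrite mulrC ler_pdivrMr//; nra.
Qed.

Lemma bump_le1 e a s : (0 < e)%R -> (0 < a)%R -> (0 < s)%R -> (bump e a s <= 1)%R.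
Proof.
move=> e0 a0 s0; have w0 : (0 < s / a)%R by rewrite divr_gt0.
rewrite /bump ge_min; have [h|/ltW h] := leP (s / a)%R 1%R; apply/orP; [left|right].
  by rewrite -[leRHS](powRr0 (s / a)); apply: ger_powR; rewrite ?w0 ?(ltW e0).
by rewrite -[leRHS](powRr0 (s / a)); apply: ler_powR; rewrite ?oppr_le0 ?(ltW e0).
Qed.

Lemma bump_ge0 e a s : (0 <= bump e a s)%R.
Proof. by rewrite le_min !powR_ge0. Qed.

(* The constant does not depend on the point [a] where the bump is centred. *)
Lemma interp_le e q : (0 < e)%R -> 1 <= q ->
  exists2 C : R, (0 < C)%R & forall x theta D a, N0 x < +oo ->
    (0 <= D)%R -> (0 < a)%R ->
    (forall s, (0 < s)%R -> (s `^ (- theta))%:E * Kfun N0 N1 s x <=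
      (D * (bump e a s + bump e 1 s))%:E) ->
    real_interp N0 N1 theta q x <= (C * D)%:E.
Proof.
move=> e0; case: q => [r|_|//]; last first.
  exists 2%R => // x theta D a hx D0 a0 h; apply: ge_ereal_sup => _ /= [s + <-].
  rewrite in_itv/= andbT => s0; apply: (le_trans (h _ s0)).
  rewrite lee_fin mulrC ler_wpM2r// -[leRHS]/(1 + 1)%R.
  by rewrite lerD ?bump_le1.
rewrite lee_fin => r1; have r0 : (0 < r)%R := lt_le_trans ltr01 r1.
have p0 : (0 < e * r)%R by rewrite mulr_gt0.
(* The 2 comes from [(u + v)^r <= 2^r (u^r + v^r)], proved by comparison with the larger of the two
   bumps; [8 = 4 + 4] adds the two uses of [bump_kern], each kernel having integral at most 1. *)
exists (2 * (8 / (e * r)) `^ (r^-1))%R.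
  by rewrite mulr_gt0 ?powR_gt0 ?divr_gt0.
move=> x theta D a hx D0 a0 h; rewrite /real_interp.
have k0 b s : (0 <= kern (e * r) b s)%R by exact: kern_ge0.
have I : \int[mu]_(s in Rp) integrand theta r x s <= ((2 * D) `^ r * (8 / (e * r)))%:E.
  apply: (@le_trans _ _ (\int[mu]_(s in Rp) (((2 * D) `^ r * (4 / (e * r)))%:E *
     ((kern (e * r) a s)%:E + (kern (e * r) 1 s)%:E)))).
    apply: ge0_le_integral => //.
    - move=> s /=; rewrite in_itv/= andbT => s0.
      by rewrite /integrand mule_ge0 ?poweR_ge0// lee_fin invr_ge0 ltW.
    - exact: measurable_integrand.
    - apply: measurable_funeM; apply: emeasurable_funD; apply/measurable_EFinP; exact: measurable_kern.
    - move=> s /=; rewrite in_itv/= andbT => s0; rewrite /integrand.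
      apply: (@le_trans _ _ ((D * (bump e a s + bump e 1 s))%:E `^ r * (s^-1)%:E)).
        rewrite lee_wpmul2r ?lee_fin ?invr_ge0 ?(ltW s0)//.
        apply: gt0_ler_poweR; rewrite ?(ltW r0)// ?h// in_itv/= leey andbT.
          by rewrite mule_ge0 ?lee_fin ?powR_ge0// (Kfun_ordered_ge0 hN)// ltW.
        by rewrite lee_fin mulr_ge0// addr_ge0// bump_ge0.
      rewrite poweR_EFin -EFinD -!EFinM lee_fin.
      rewrite -mulrA [(4 / _ * _)%R]mulrDr.
      apply: (@le_trans _ _ ((2 * D) `^ r * ((bump e a s) `^ r / s + (bump e 1 s) `^ r / s))%R).
        rewrite -mulrDl mulrA ler_wpM2r ?invr_ge0 ?(ltW s0)//.
        have b1 := bump_ge0 e a s; have b2 := bump_ge0 e 1 s.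
        have [bb|/ltW bb] := leP (bump e a s) (bump e 1 s).
          apply: (@le_trans _ _ ((2 * D * bump e 1 s) `^ r)%R).
            apply: ge0_ler_powR; [exact: ltW r0|by rewrite nnegrE mulr_ge0 ?addr_ge0|by rewrite nnegrE !mulr_ge0|].
            by rewrite (mulrC 2%R) -mulrA ler_wpM2l//; lra.
          rewrite powRM ?mulr_ge0// ler_wpM2l ?powR_ge0// lerDr powR_ge0//.
        apply: (@le_trans _ _ ((2 * D * bump e a s) `^ r)%R).
          apply: ge0_ler_powR; [exact: ltW r0|by rewrite nnegrE mulr_ge0 ?addr_ge0|by rewrite nnegrE !mulr_ge0|].
          by rewrite (mulrC 2%R) -mulrA ler_wpM2l//; lra.
        by rewrite powRM ?mulr_ge0// ler_wpM2l ?powR_ge0// lerDl powR_ge0.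
      by rewrite ler_wpM2l ?powR_ge0// lerD// bump_kern.
  rewrite ge0_integralZl_EFin//; last 3 first.
  - by move=> s _; rewrite adde_ge0 ?lee_fin.
  - apply: emeasurable_funD; apply/measurable_EFinP; exact: measurable_kern.
  - by rewrite mulr_ge0 ?powR_ge0// divr_ge0// ltW.
  rewrite ge0_integralD//=; try by move=> s _; rewrite lee_fin.
  all: try by apply/measurable_EFinP; exact: measurable_kern.
  apply: (@le_trans _ _ (((2 * D) `^ r * (4 / (e * r)))%:E * (1 + 1))).
    rewrite lee_wpmul2l//; first by rewrite lee_fin mulr_ge0 ?powR_ge0// divr_ge0// ltW.
    by rewrite leeD// integral_kern.
  by rewrite -EFinD -EFinM lee_fin le_eqVlt; apply/orP; left; apply/eqP; field; rewrite !gt_eqF.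
apply: (@le_trans _ _ (((2 * D) `^ r * (8 / (e * r)))%:E `^ r^-1)).
  apply: gt0_ler_poweR => //; rewrite ?invr_ge0 ?(ltW r0)// in_itv/= leey andbT.
    apply: integral_ge0 => s /=; rewrite in_itv/= andbT => s0.
    by rewrite /integrand mule_ge0 ?poweR_ge0// lee_fin invr_ge0 ltW.
  by rewrite lee_fin mulr_ge0 ?powR_ge0// divr_ge0// ltW.
have c8 : (0 <= 8 / (e * r))%R by rewrite divr_ge0// ltW.
have d2 : (0 <= 2 * D)%R by rewrite mulr_ge0.
rewrite poweR_EFin lee_fin (powRM _ (powR_ge0 _ _) c8) -powRrM mulfV ?gt_eqF//.
by rewrite (powRr1 d2) -!mulrA (mulrC D).
Qed.

End interpolation_norm.

Lemma Kfun_geZ {R : realType} {V : lmodType R} (N0 N1 : V -> \bar R) (t c : R)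
    (x : V) (y : \bar R) : 0 < c ->
  (forall x0 x1 : V, x = x0 + x1 -> (N0 x0 < +oo)%E -> (N1 x1 < +oo)%E ->
     (y <= c%:E * (N0 x0 + t%:E * N1 x1))%E) -> (y <= c%:E * Kfun N0 N1 t x)%E.
Proof.
move=> c0 h; rewrite -lee_pdivrMl//; apply: Kfun_ge => x0 x1 xE h0 h1.
by rewrite lee_pdivrMl//; exact: h.
Qed.

Lemma I01E {R : realType} (t : R) : @I01 R t <-> 0 <= t <= 1.
Proof. by rewrite /I01/= in_itv. Qed.

Lemma monotone_measurable_I01 {R : realType} (f : R -> R) :
  (forall s t, 0 <= s -> s <= t -> t <= 1 -> f s <= f t) ->
  measurable_fun (@I01 R) f.
Proof.
move=> fnd; pose g t := f (Num.max 0 (Num.min t 1)).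
apply: (eq_measurable_fun g).
  move=> t; rewrite inE => /I01E/andP[t0 t1].
  by rewrite /g min_l// max_r.
apply: nondecreasing_measurable => [|s t st]; first exact: measurable_itv.
rewrite /g fnd//; first by rewrite le_max lexx.
  by rewrite ge_max le_max lexx/= le_max le_min !ge_min st lexx !orbT.
by rewrite ge_max ler01/= ge_min lexx orbT.
Qed.

Lemma measurable_fine_Kfun {R : realType} {V : lmodType R} (N0 N1 : V -> \bar R) (x : V) :
  (forall x, 0 <= N0 x)%E -> (forall x, 0 <= N1 x)%E -> N1 0 = 0%E ->
  (N0 x < +oo)%E -> measurable_fun (@I01 R) (fun t => fine (Kfun N0 N1 t x)).
Proof.
move=> N00 N10 N1_0 h; apply: monotone_measurable_I01 => s t s0 st _.
have K (u : R) : 0 <= u -> Kfun N0 N1 u x \is a fin_num.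
  move=> u0; rewrite ge0_fin_numE ?Kfun_ge0//.
  exact: le_lt_trans (Kfun_le0 _ _ _ N1_0) h.
by apply: fine_le; rewrite ?K//; [exact: le_trans st|exact: le_Kfun].
Qed.

Section same_space_lemmas.
Context {R : realType} {V : lmodType R}.
Local Open Scope ereal_scope.

Lemma same_space_sym (N M : V -> \bar R) : same_space N M -> same_space M N.
Proof.
move=> [NM [c c0 h]]; split=> [x|]; first by rewrite NM.
by exists c => // x /NM /h[].
Qed.

Lemma same_space_le (N M : V -> \bar R) (a b : R) :
  (forall x, 0 <= N x) -> (forall x, 0 <= M x) -> (0 <= a)%R -> (0 <= b)%R ->
  (forall x, N x <= a%:E * M x) -> (forall x, M x <= b%:E * N x) ->
  same_space N M.
Proof.
move=> N0 M0 a0 b0 NM MN; split.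
  move=> x; split=> h; [apply: (le_lt_trans (MN x))|apply: (le_lt_trans (NM x))];
    by rewrite lte_mul_pinfty.
exists (a + b + 1)%R; first by rewrite ltr_wpDl// addr_ge0.
move=> x _; split.
  by apply: (le_trans (NM x)); rewrite lee_wpmul2r// lee_fin -addrA lerDl addr_ge0.
by apply: (le_trans (MN x)); rewrite lee_wpmul2r// lee_fin addrAC lerDr addr_ge0.
Qed.

Lemma same_space_leP (N M : V -> \bar R) : same_space N M ->
  exists2 c : R, (0 < c)%R & forall x, N x <= c%:E * M x.
Proof.
move=> [NM [c c0 h]]; exists c => // x.
have [/h[]//|] := ltP (N x) +oo.
rewrite leye_eq => /eqP Nx; have : ~ M x < +oo by move=> /NM; rewrite Nx ltxx.
by move/negP; rewrite -leNgt leye_eq => /eqP ->; rewrite gt0_muley ?leey// lte_fin.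
Qed.

Lemma same_space_trans (N M P : V -> \bar R) : (forall x, 0 <= N x) ->
  (forall x, 0 <= P x) ->
  same_space N M -> same_space M P -> same_space N P.
Proof.
move=> N0 P0 NM MP.
have [a a0 ha] := same_space_leP NM; have [b b0 hb] := same_space_leP MP.
have [c c0 hc] := same_space_leP (same_space_sym NM).
have [d d0 hd] := same_space_leP (same_space_sym MP).
apply: (@same_space_le _ _ (a * b)%R (d * c)%R); rewrite ?mulr_ge0 ?ltW// => x.
  by apply: (le_trans (ha x)); rewrite EFinM -muleA lee_wpmul2l ?lee_fin ?(ltW a0).
by apply: (le_trans (hd x)); rewrite EFinM -muleA lee_wpmul2l ?lee_fin ?(ltW d0).
Qed.

End same_space_lemmas.

(** * Comparison of [K] with the K-functional of the pair [(A0, A_theta,q)] *)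

Section intermediate_space.
Context {R : realType} {V : lmodType R}.
Variables N0 N1 : V -> \bar R.
Hypothesis hN : ordered_norms N0 N1.
Variables (theta : R) (q : \bar R).
Hypotheses (theta01 : 0 < theta < 1) (q1 : (1 <= q)%E).
Local Open Scope ereal_scope.
Notation Nt := (real_interp N0 N1 theta q).

Lemma interp_ge0 x : 0 <= Nt x.
Proof.
rewrite /real_interp; case: q q1 => [r _|_|//]; first exact: poweR_ge0.
apply: (@le_trans _ _ ((1%R `^ (- theta))%:E * Kfun N0 N1 1 x)).
  by rewrite mule_ge0 ?lee_fin ?powR_ge0// (Kfun_ordered_ge0 hN).
by apply: ereal_sup_ubound; exists 1%R => //=; rewrite in_itv/= ltr01.
Qed.

(** From [K(s, x) <= min(1, s) N1 x], the weighted K-functional is at most [N1 x] times a bump at 1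
    with exponent [min(theta, 1 - theta)]. Asking for [1 <= C] lets the same constant cover the [N0]
    summand in [Kfun_interp_le]. *)
Lemma interp_embedded : exists2 C : R, (1 <= C)%R &
  forall x, N1 x < +oo -> Nt x <= C%:E * N1 x.
Proof.
have /andP[th0 th1] := theta01.
pose e := Num.min theta (1 - theta)%R.
have e0 : (0 < e)%R by rewrite lt_min th0 subr_gt0.
have [C C0 h] := interp_le hN e0 q1.
exists (C + 1)%R; first by rewrite lerDr ltW.
move=> x N1x.
have N1f : N1 x \is a fin_num by rewrite ge0_fin_numE ?(onorm1_ge0 hN).
have N1f0 : (0 <= fine (N1 x))%R by rewrite fine_ge0// (onorm1_ge0 hN).
have N0x := le_lt_trans (onorm_le hN x) N1x.
apply: (@le_trans _ _ (C * fine (N1 x))%:E); last first.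
  by rewrite EFinM fineK// lee_wpmul2r ?(onorm1_ge0 hN)// lee_fin lerDl.
apply: (h x theta (fine (N1 x)) 1%R) => // s s0.
have K1 : Kfun N0 N1 s x <= (fine (N1 x))%:E.
  by rewrite fineK// (le_trans (Kfun_le0 _ _ _ (onorm1_0 hN)))// (onorm_le hN).
have K2 : Kfun N0 N1 s x <= s%:E * (fine (N1 x))%:E.
  by rewrite fineK//; apply: Kfun_le1 => //; exact: (onorm0_0 hN).
have bE : (s `^ (- theta) * Num.min 1 s <= bump e 1 s)%R.
  rewrite /bump divr1 le_min; have [s1|/ltW s1] := leP s 1%R.
    have h1 : (s `^ (- theta) * s <= s `^ e)%R.
      rewrite -{2}(powRr1 (ltW s0)) -powRD; last by rewrite (gt_eqF s0) implybT.
      rewrite addrC; apply: ger_powR; first by rewrite s0.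
      by rewrite ge_min lexx orbT.
    rewrite h1/=; apply: (le_trans h1); apply: ger_powR; first by rewrite s0.
    by rewrite (@le_trans _ _ 0%R)// ?oppr_le0 ltW.
  rewrite mulr1; have h1 : (s `^ (- theta) <= s `^ (- e))%R.
    by apply: ler_powR => //; rewrite lerN2 ge_min lexx.
  rewrite h1 andbT; apply: (le_trans h1); apply: ler_powR => //.
  by rewrite (@le_trans _ _ 0%R)// ?oppr_le0 ltW.
apply: (@le_trans _ _ (s `^ (- theta) * (Num.min 1 s * fine (N1 x)))%:E).
  rewrite EFinM lee_wpmul2l ?lee_fin ?powR_ge0//.
  by case: (leP 1%R s) => _; rewrite ?mul1r.
rewrite lee_fin mulrA mulrC ler_wpM2l// (le_trans bE)//.
by rewrite lerDl bump_ge0.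
Qed.

Lemma interp0 : Nt 0%R = 0.
Proof.
have [C _ /(_ 0%R)] := interp_embedded; rewrite (onorm1_0 hN) mule0 => /(_ (ltry _)).
by move=> h; apply/eqP; rewrite eq_le h interp_ge0.
Qed.

Lemma onorm_interp x : N0 x <= 4%:E * Nt x.
Proof.
apply: (le_trans (Kfun1_ge hN x)).
by apply: (le_trans (Kfun_le_interp hN x theta01 q1 ltr01)); rewrite powR1 mulr1.
Qed.

Lemma in_sum_interp x : in_sum N0 Nt x <-> N0 x < +oo.
Proof.
split=> [[x0 [x1 [-> h0 h1]]]|N0x].
  apply: (le_lt_trans (onormD hN _ _)); rewrite lte_add_pinfty//.
  by apply: (le_lt_trans (onorm_interp x1)); rewrite lte_mul_pinfty.
by exists x, 0%R; rewrite addr0 N0x interp0.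
Qed.

Lemma Kfun_interp_fin_num t x : (0 <= t)%R -> N0 x < +oo ->
  Kfun N0 Nt t x \is a fin_num.
Proof.
move=> t0 h; rewrite ge0_fin_numE ?Kfun_ge0//; [|exact: (onorm_ge0 hN)|exact: interp_ge0].
exact: le_lt_trans (Kfun_le0 _ _ _ interp0) h.
Qed.

Lemma measurable_Kfun_interp x : N0 x < +oo ->
  measurable_fun (@I01 R) (fun t => fine (Kfun N0 Nt t x)).
Proof.
move=> h; apply: measurable_fine_Kfun => //;
  [exact: (onorm_ge0 hN)|exact: interp_ge0|exact: interp0].
Qed.

Lemma Kfun_interp_le : exists2 C : R, (0 < C)%R &
  forall t x, (0 <= t)%R -> Kfun N0 Nt t x <= C%:E * Kfun N0 N1 t x.
Proof.
have [C C1 hC] := interp_embedded; have C0 := lt_le_trans ltr01 C1.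
exists C => // t x t0; apply: Kfun_geZ => // x0 x1 xE h0 h1.
apply: (le_trans (Kfun_le_dec t xE h0 _)).
  by apply: (le_lt_trans (hC _ h1)); rewrite lte_mul_pinfty ?(onorm1_ge0 hN) ?lee_fin ?(ltW C0).
rewrite muleDr ?ge0_adde_def ?inE ?(onorm_ge0 hN) ?mule_ge0 ?(onorm1_ge0 hN)//.
apply: leeD.
  by rewrite -[leLHS]mul1e lee_wpmul2r ?(onorm_ge0 hN) ?lee_fin.
by rewrite muleCA lee_wpmul2l ?hC ?lee_fin.
Qed.

(** The easy half of Holmstedt's formula: for [x = x0 + x1], [K(t, x) <= N0 x0 + K(t, x1)], and the
    last term is at most [4 t^theta Nt x1] by [Kfun_le_interp]. *)
Lemma Kfun_le_Kfun_interp t x : (0 < t)%R ->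
  Kfun N0 N1 t x <= 4%:E * Kfun N0 Nt (t `^ theta) x.
Proof.
move=> t0; apply: Kfun_geZ => // x0 x1 xE h0 h1.
have xE' : x1 = (- x0 + x)%R by rewrite xE addKr.
have := Kfun_sub_le hN t xE'; rewrite (onormN hN) => /(_ h0) K.
apply: (le_trans K).
rewrite addeC muleDr ?ge0_adde_def ?inE ?(onorm_ge0 hN) ?mule_ge0 ?interp_ge0 ?lee_fin ?powR_ge0//.
apply: leeD.
  by rewrite -[leLHS]mul1e lee_wpmul2r ?(onorm_ge0 hN)// lee_fin ler1n.
by rewrite muleA -EFinM; exact: Kfun_le_interp.
Qed.

End intermediate_space.

#[local] Instance lebesgue_ae_filter {R : realType} :
  Filter (almost_everywhere (@lebesgue_measure R)).
Proof. exact: ae_filter_ringOfSetsType. Qed.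

(** * Lattices on the unit interval *)

Section lattice.
Context {R : realType}.
Variable G : (R -> R) -> \bar R.
Hypothesis hG : banach_lattice G.
Local Open Scope ereal_scope.
Notation mu := (@lebesgue_measure R).

(** The point 0 is null, so estimates that rest on powers and quotients need only be checked on []0,
    1]]. *)
Lemma ae_I01 (P : R -> Prop) : (forall t : R, (0 < t <= 1)%R -> P t) ->
  {ae mu, forall t, I01 t -> P t}.
Proof.
move=> h; exists [set 0%R]; split; [exact: measurable_set1|exact: lebesgue_measure_set1|].
move=> t /=; apply: contra_notP => t0 /I01E/andP[t0' t1]; apply: h.
by rewrite t1 andbT lt_neqAle t0' andbT eq_sym; apply/eqP.
Qed.

Lemma lattice_leM (f g : R -> R) (c : R) : (0 <= c)%R ->
  measurable_fun (@I01 R) f ->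
  {ae mu, forall t, I01 t -> (`|f t| <= c * `|g t|)%R} -> G f <= c%:E * G g.
Proof.
move=> c0 mf fg; rewrite -[X in X%:E](ger0_norm c0) -(lattice_scale hG).
apply: (lattice_le hG) => //; apply: filterS fg => t h It.
by rewrite /GRing.scale/= normrM (ger0_norm c0); exact: h.
Qed.

Lemma lattice_leM_pointwise (f g : R -> R) (c : R) : (0 <= c)%R ->
  measurable_fun (@I01 R) f ->
  (forall t : R, (0 < t <= 1)%R -> (`|f t| <= c * `|g t|)%R) -> G f <= c%:E * G g.
Proof. by move=> c0 mf fg; apply: lattice_leM => //; exact: ae_I01. Qed.

Lemma bounded_on_ge0 (T : (R -> R) -> R -> R) : bounded_on G T ->
  exists2 C : R, (0 <= C)%R & forall f, G f < +oo -> G (T f) <= C%:E * G f.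
Proof.
move=> [C hC]; exists (Num.max 0 C)%R; first by rewrite le_max lexx.
move=> f /hC h; apply: (le_trans h).
by rewrite lee_wpmul2r ?(lattice_ge0 hG)// lee_fin le_max lexx orbT.
Qed.

Lemma bounded_on_comp (S T : (R -> R) -> R -> R) :
  bounded_on G S -> bounded_on G T -> bounded_on G (S \o T).
Proof.
move=> /bounded_on_ge0[C C0 hC] /bounded_on_ge0[D D0 hD]; exists (C * D)%R => f h.
have hT := hD f h.
have Tf : G (T f) < +oo by rewrite (le_lt_trans hT)// lte_mul_pinfty ?lee_fin.
apply: (le_trans (hC _ Tf)).
by rewrite EFinM -muleA lee_wpmul2l ?lee_fin.
Qed.

Lemma bounded_on_iter_sqrt n : bounded_on G (fun f t => f (Num.sqrt t)) ->
  bounded_on G (fun f t => f (iter n Num.sqrt t)).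
Proof.
move=> h; elim: n => [|n IH]; first by exists 1%R => f _; rewrite mul1e.
by have := bounded_on_comp IH h.
Qed.

Lemma iter_sqrtE n (t : R) : (0 <= t)%R -> iter n Num.sqrt t = (t `^ ((2^-1) ^+ n))%R.
Proof.
move=> t0; elim: n => [|n IH]; first by rewrite expr0 powRr1.
by rewrite iterS IH -powR12_sqrt ?powR_ge0// -powRrM -exprSr.
Qed.

Lemma half_expn_le (e : R) : (0 < e)%R -> exists n : nat, ((2^-1) ^+ n <= e)%R.
Proof.
move=> e0; have : (2^-1 ^+ n)%R @[n --> \oo] --> (0:R)%R.
  by apply: cvg_expr; rewrite ger0_norm// invf_lt1// ltr1n.
move/cvgrPdist_le => /(_ e e0) [n _ /(_ n (leqnn n))].
by rewrite sub0r normrN ger0_norm ?exprn_ge0// => h; exists n.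
Qed.

Section interpolation.
Context {V : lmodType R}.
Variables N0 N1 : V -> \bar R.
Hypothesis hN : ordered_norms N0 N1.

Lemma Kspace_ge0 (M0 M1 : V -> \bar R) x : 0 <= Kspace G M0 M1 x.
Proof. by rewrite /Kspace; case: ifP => // _; exact: (lattice_ge0 hG). Qed.

Lemma Kspace_interp theta q x : (0 < theta < 1)%R -> 1 <= q -> N0 x < +oo ->
  Kspace G N0 (real_interp N0 N1 theta q) x =
  G (fun t => fine (Kfun N0 (real_interp N0 N1 theta q) t x)).
Proof.
by move=> th q1 h; rewrite /Kspace asboolT//; apply/(in_sum_interp hN th q1).
Qed.

Lemma Kspace_interp_notin theta q x : (0 < theta < 1)%R -> 1 <= q -> ~ N0 x < +oo ->
  Kspace G N0 (real_interp N0 N1 theta q) x = +oo.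
Proof.
by move=> th q1 h; rewrite /Kspace asboolF// => /(in_sum_interp hN th q1).
Qed.

Lemma sqrt_bounded_Kspace theta q : (0 < theta < 1)%R -> 1 <= q ->
  bounded_on G (fun f t => f (Num.sqrt t)) ->
  same_space (Kspace G N0 N1) (Kspace G N0 (real_interp N0 N1 theta q)).
Proof.
move=> th q1 bR; have /andP[th0 th1] := th.
(* Here [2^-n <= theta], so [t^theta <= t^(2^-n)] on []0, 1]], and the right side is the [n]-fold
   square root of [t]. Hence [K(t, x) <= 4 K_theta(t^(2^-n), x)]. *)
have [n nth] := half_expn_le th0.
have [B B0 hB] := bounded_on_ge0 (bounded_on_iter_sqrt n bR).
have [C C0 hC] := Kfun_interp_le hN th q1.
(* [B] may be 0, and [0 * +oo = 0] would spoil the inequality at elements of infinite norm. *)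
have B1 : (0 < B + 1)%R by rewrite ltr_wpDl.
set Nt := real_interp N0 N1 theta q in hC *.
have Nt0 : forall x, 0 <= Nt x := interp_ge0 hN theta q1.
have Ktf t x : (0 <= t)%R -> N0 x < +oo -> Kfun N0 Nt t x \is a fin_num.
  exact: (Kfun_interp_fin_num hN th q1).
have Ktg t x : (0 <= t)%R -> (0 <= fine (Kfun N0 Nt t x))%R.
  by move=> t0; rewrite fine_ge0// Kfun_ge0//; exact: (onorm_ge0 hN).
have Kg t x : (0 <= t)%R -> (0 <= fine (Kfun N0 N1 t x))%R.
  by move=> t0; rewrite fine_ge0// (Kfun_ordered_ge0 hN).
apply: (@same_space_le _ _ _ _ (4 * (B + 1))%R C).
- exact: Kspace_ge0.
- exact: Kspace_ge0.
- by rewrite mulr_ge0// ltW.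
- exact: ltW.
- move=> x; have [h|h] := pselect (N0 x < +oo); last first.
    by rewrite Kspace_interp_notin// gt0_muley ?leey// lte_fin mulr_gt0.
  rewrite Kspace_interp// /Kspace asboolT; last exact/(in_sum_ordered hN).
  set k := fun t => fine (Kfun N0 Nt t x).
  have mk : measurable_fun (@I01 R) k by exact: (measurable_Kfun_interp hN).
  have [kf|] := ltP (G k) +oo; last first.
    by rewrite leye_eq => /eqP ->; rewrite gt0_muley ?leey// lte_fin mulr_gt0.
  apply: (@le_trans _ _ (4%:E * G (fun t => k (iter n Num.sqrt t)))); last first.
    rewrite EFinM -muleA lee_wpmul2l// (le_trans (hB _ kf))//.
    by rewrite lee_wpmul2r ?(lattice_ge0 hG)// lee_fin lerDl.
  apply: lattice_leM_pointwise => //.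
    apply: measurable_fine_Kfun => //; [exact: (onorm_ge0 hN)|exact: (onorm1_ge0 hN)|exact: (onorm1_0 hN)].
  move=> t /andP[t0 t1]; rewrite iter_sqrtE ?(ltW t0)// ger0_norm ?Kg ?(ltW t0)//.
  rewrite ger0_norm ?Ktg ?powR_ge0// -lee_fin EFinM fineK ?(Kfun_fin_num hN) ?(ltW t0)//.
  rewrite /k fineK ?Ktf ?powR_ge0//.
  apply: (le_trans (Kfun_le_Kfun_interp hN th q1 x t0)).
  rewrite lee_wpmul2l// le_Kfun// ger_powR// t0//.
- move=> x; have [h|h] := pselect (N0 x < +oo); last first.
    rewrite [X in _ <= _ * X]/Kspace asboolF; last by move/(in_sum_ordered hN).
    by rewrite gt0_muley ?leey// lte_fin.
  rewrite Kspace_interp// /Kspace asboolT; last exact/(in_sum_ordered hN).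
  apply: lattice_leM_pointwise => //; first exact: ltW.
    exact: (measurable_Kfun_interp hN).
  move=> t /andP[/ltW t0 t1]; rewrite !ger0_norm ?Kg ?Ktg//.
  by rewrite -lee_fin EFinM !fineK ?(Kfun_fin_num hN) ?Ktf// hC.
Qed.

End interpolation.
End lattice.

(** * Quasi-concave functions and dilations *)

Section quasiconcave.
Context {R : realType}.
Implicit Types (phi psi : R -> R) (s t : R).

(** [qc_div] is the monotonicity of [phi(t) / t], multiplied out. Strict positivity leaves room for
    a decomposition that only nearly attains the infimum in a K-functional bounded by [phi]. *)
Record quasiconcave phi : Prop := {
  qc_ge0 : 0 <= phi 0;
  qc_gt0 : forall t, 0 < t <= 1 -> 0 < phi t;
  qc_nd : forall s t, 0 <= s -> s <= t -> t <= 1 -> phi s <= phi t;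
  qc_div : forall s t, 0 < s -> s <= t -> t <= 1 -> s * phi t <= t * phi s }.

(* For a quasi-concave [phi] this says that [phi] tends to 0 at 0. *)
Definition vanishing phi := forall e : R, 0 < e ->
  exists2 s, 0 < s <= 1 & phi s < e.

Lemma powR_I01 (d t : R) : 0 <= d -> 0 < t <= 1 -> 0 < t `^ d <= 1.
Proof.
move=> d0 /andP[t0 t1]; rewrite powR_gt0//= -[leRHS](powRr0 t).
by apply: ger_powR => //; rewrite t0.
Qed.

Lemma quasiconcave_powR phi (d : R) : 0 < d <= 1 -> quasiconcave phi ->
  quasiconcave (fun t => phi (t `^ d)).
Proof.
move=> /andP[d0 d1] qphi; split.
- by rewrite powR0 ?gt_eqF// (qc_ge0 qphi).
- by move=> t t01; apply: (qc_gt0 qphi); apply: powR_I01 => //; exact: ltW.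
- move=> s t s0 st t1; apply: (qc_nd qphi); first exact: powR_ge0.
    by apply: ge0_ler_powR; rewrite ?nnegrE ?(ltW d0)//; exact: le_trans st.
  have [->|t0] := eqVneq t 0; first by rewrite powR0 ?gt_eqF.
  have t0' : 0 < t by rewrite lt_neqAle eq_sym t0 (le_trans s0 st).
  by have /andP[] := @powR_I01 d t (ltW d0) (introT andP (conj t0' t1)).
- move=> s t s0 st t1; have t0 := lt_le_trans s0 st.
  have s1 := le_trans st t1.
  have /andP[sd0 sd1] := @powR_I01 d s (ltW d0) (introT andP (conj s0 s1)).
  have /andP[td0 td1] := @powR_I01 d t (ltW d0) (introT andP (conj t0 t1)).
  have sdtd : s `^ d <= t `^ d.
    by apply: ge0_ler_powR; rewrite ?nnegrE ?(ltW d0) ?(ltW s0) ?(ltW t0).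
  have h := qc_div qphi sd0 sdtd td1.
  have f0 : 0 < phi (s `^ d) by apply: (qc_gt0 qphi); rewrite sd0.
  (* [t^d / s^d <= t / s], since [(t / s)^(1 - d) >= 1] *)
  have h2 : s * t `^ d <= t * s `^ d.
    have e1 : t = t `^ d * t `^ (1 - d).
      by rewrite -powRD ?(gt_eqF t0) ?implybT// addrC subrK powRr1// ltW.
    have e2 : s = s `^ d * s `^ (1 - d).
      by rewrite -powRD ?(gt_eqF s0) ?implybT// addrC subrK powRr1// ltW.
    have le1 : s `^ (1 - d) <= t `^ (1 - d).
      by apply: ge0_ler_powR; rewrite ?nnegrE ?subr_ge0 ?(ltW s0) ?(ltW t0).
    rewrite {1}e2 {2}e1; move: (s `^ d) (t `^ d) (s `^ _) (t `^ _) le1 sd0 td0.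
    move=> a c b f bf a0 c0; rewrite mulrAC [leRHS]mulrAC [leRHS]mulrC.
    by rewrite (_ : f * (c * a) = a * c * f) 1?ler_pM2l ?mulr_gt0//; ring.
  rewrite -(ler_pM2l sd0).
  rewrite mulrCA; apply: (@le_trans _ _ (s * (t `^ d * phi (s `^ d)))).
    by rewrite ler_wpM2l// ltW.
  by rewrite mulrA [leRHS]mulrA [_ * t]mulrC ler_wpM2r// ltW.
Qed.

Lemma vanishing_powR phi (d : R) : 0 < d -> vanishing phi ->
  vanishing (fun t => phi (t `^ d)).
Proof.
move=> d0 h e /h[s s01 es]; exists (s `^ d^-1).
  by apply: powR_I01; rewrite ?invr_ge0 ?(ltW d0).
have /andP[s0 _] := s01.
by rewrite -powRrM mulVf ?gt_eqF// powRr1// ltW.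
Qed.

Lemma measurable_quasiconcave phi : quasiconcave phi -> measurable_fun (@I01 R) phi.
Proof. by move=> q; apply: monotone_measurable_I01; exact: (qc_nd q). Qed.

Lemma quasiconcave_le_split phi t u : quasiconcave phi -> 0 < t <= 1 -> 0 < u <= 1 ->
  phi u <= phi t * (1 + u / t).
Proof.
move=> q t01 u01; have /andP[t0 t1] := t01; have /andP[u0 u1] := u01.
have ft := qc_gt0 q t01.
have [ut|/ltW tu] := leP u t.
  apply: (le_trans (qc_nd q (ltW u0) ut t1)).
  by rewrite ler_pMr// lerDl divr_ge0// ltW.
have := qc_div q t0 tu u1; rewrite mulrC -ler_pdivlMr// => h.
apply: (le_trans h); rewrite (_ : u * phi t / t = phi t * (u / t)); last by ring.
by rewrite ler_wpM2l ?(ltW ft)// lerDr.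
Qed.

End quasiconcave.

Section dilation.
Context {R : realType} {V : lmodType R}.
Variables N0 N1 : V -> \bar R.
Hypothesis hN : ordered_norms N0 N1.
Local Open Scope ereal_scope.

(** A form of K-abundance on []0, 1]]. The constant is uniform in [psi], so that a bound on elements
    of the pair becomes a bound on all vanishing quasi-concave functions at once. *)
Definition realizing := exists2 C : R, (0 < C)%R & forall psi,
  quasiconcave psi -> vanishing psi -> exists2 x, N0 x < +oo &
  forall s, (0 < s <= 1)%R ->
    (psi s)%:E <= C%:E * Kfun N0 N1 s x /\ Kfun N0 N1 s x <= (C * psi s)%:E.

(** A nearly optimal decomposition at [t^(1/theta)] has [N0 x0] of order
    [phi(t^(alpha/theta)) <= phi(t)]. The norm of [x1] in the interpolation space is estimated from
    three bounds on [K(s, x1)]: by [s N1 x1] below the cut, by quasi-concavity between the cut and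
    1, by a constant beyond 1. Weighted by [s^(-theta)], all three fit under bumps at the cut and at
    1. *)
Lemma Kfun_interp_le_quasiconcave (theta alpha C : R) (q : \bar R) :
  (0 < theta < 1)%R -> (theta < alpha < 1)%R -> (0 < C)%R -> 1 <= q ->
  exists2 D : R, (0 < D)%R & forall phi x, quasiconcave phi -> N0 x < +oo ->
    (forall s, (0 < s <= 1)%R -> Kfun N0 N1 s x <= (C * phi (s `^ alpha))%:E) ->
    forall t, (0 < t <= 1)%R ->
      Kfun N0 (real_interp N0 N1 theta q) t x <= (D * phi t)%:E.
Proof.
move=> th /andP[tha alpha1] C0 q1; have /andP[th0 th1] := th.
have alpha0 := lt_trans th0 tha.
(* The decay rates that occur: [1 - theta] below the cut, [theta] above it and above 1, and
   [alpha - theta] to the left of 1. *)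
pose e := (Num.min (Num.min theta (1 - theta)) (alpha - theta))%R.
have e0 : (0 < e)%R by rewrite !lt_min th0 !subr_gt0 th1 tha.
have eth : (e <= theta)%R by rewrite !ge_min lexx.
have e1th : (e <= 1 - theta)%R by rewrite !ge_min lexx orbT.
have eath : (e <= alpha - theta)%R by rewrite !ge_min lexx orbT.
have [B B0 hB] := interp_le hN e0 q1.
exists (2 * C + B * (4 * C))%R; first by rewrite addr_gt0 ?mulr_gt0.
move=> phi x qphi N0x hK t t01; have /andP[t0 t1] := t01.
have ft := qc_gt0 qphi t01.
(* Cut [x] at [s0 = t^(1/theta)], as in Holmstedt's formula. *)
pose s0 := (t `^ theta^-1)%R.
have s001 : (0 < s0 <= 1)%R by apply: powR_I01 => //; rewrite invr_ge0 ltW.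
have /andP[s00 s01] := s001.
have s0th : (s0 `^ theta = t)%R by rewrite -powRrM mulVf ?gt_eqF// powRr1// ltW.
have hs0 : Kfun N0 N1 s0 x < (2 * C * phi t)%:E.
  apply: (le_lt_trans (hK _ s001)); rewrite lte_fin.
  apply: (@le_lt_trans _ _ (C * phi t)%R).
    rewrite ler_wpM2l ?(ltW C0)//; apply: (qc_nd qphi) => //; first exact: powR_ge0.
    by rewrite -powRrM; apply: ge1r_powR; rewrite ?t0// mulrC ler_pdivlMr// mul1r ltW.
  by rewrite -mulrA mulr_natl mulr2n ltrDl mulr_gt0.
have [x0 [x1 [xE h0 h1 hx]]] := Kfun_lt_dec hs0.
have N0x0 := onorm_ge0 hN x0; have N1x1 := onorm1_ge0 hN x1.
have hx0 : N0 x0 <= (2 * C * phi t)%:E.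
  by apply: le_trans (ltW hx); rewrite leeDl// mule_ge0// lee_fin ltW.
have hx1 : s0%:E * N1 x1 <= (2 * C * phi t)%:E.
  by apply: le_trans (ltW hx); rewrite leeDr.
have N0x1 : N0 x1 < +oo := le_lt_trans (onorm_le hN x1) h1.
(* [quasiconcave_le_split] at [u = s^alpha] contributes [1 + s^alpha / t]; the cost [2 C phi(t)] of
   removing [x0] makes it 3. *)
have K1 s : (0 < s <= 1)%R ->
    Kfun N0 N1 s x1 <= (C * phi t * (3 + s `^ alpha / t))%:E.
  move=> s01'; apply: (le_trans (Kfun_sub_le hN s xE h0)).
  apply: (le_trans (leeD (hK _ s01') hx0)); rewrite -EFinD lee_fin.
  have := quasiconcave_le_split qphi t01 (powR_I01 (ltW alpha0) s01').
  rewrite -(ler_pM2l C0); lra.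
have K2 s : (1 <= s)%R -> Kfun N0 N1 s x1 <= (C * phi t * (2 + t^-1))%:E.
  move=> s1; apply: (le_trans (Kfun_sub_le hN s xE h0)).
  have h : Kfun N0 N1 s x <= (C * phi 1)%:E.
    apply: (le_trans (Kfun_le0 _ _ _ (onorm1_0 hN))).
    apply: (le_trans (Kfun1_ge hN x)).
    by have := hK 1%R; rewrite powR1; apply; rewrite ltr01 lexx.
  apply: (le_trans (leeD h hx0)); rewrite -EFinD lee_fin.
  have h2 : (phi 1 <= phi t / t)%R.
    by rewrite ler_pdivlMr// mulrC -[leRHS]mul1r; apply: (qc_div qphi).
  move: h2; rewrite -(ler_pM2l C0); lra.
have K3 s : (0 < s)%R -> Kfun N0 N1 s x1 <= (2 * C * phi t * (s / s0))%:E.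
  move=> sp; apply: (le_trans (Kfun_le1 N1 x1 (onorm0_0 hN) sp)).
  rewrite (_ : (_ * (s / s0)) = s * (s0^-1 * (2 * C * phi t)))%R; last by ring.
  rewrite EFinM lee_wpmul2l ?lee_fin ?(ltW sp)//.
  by rewrite EFinM lee_pdivlMl.
have sdec : (forall s, 0 < s -> s `^ (- theta) = t^-1 * (s / s0) `^ (- theta))%R.
  move=> s sp; rewrite powR_div// [(s0 `^ _)%R]powRN s0th invrK mulrC mulfK//.
  by rewrite gt_eqF.
have main : real_interp N0 N1 theta q x1 <= (B * (4 * C * phi t / t))%:E.
  apply: (hB x1 theta _ s0) => //.
    by rewrite divr_ge0 ?mulr_ge0// ltW.
  move=> s sp; have ss0 : (0 < s / s0)%R by rewrite divr_gt0.
  have CP : (0 < C * phi t / t)%R by rewrite divr_gt0 ?mulr_gt0.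
  rewrite (_ : 4 * C * phi t / t = C * phi t / t * 4)%R; last by ring.
  have b1 := bump_ge0 e s0 s; have b2 := bump_ge0 e 1 s.
  have tS : (t * s `^ (- theta) = (s / s0) `^ (- theta))%R.
    by rewrite sdec// mulrA mulfV ?gt_eqF// mul1r.
  have [sles0|/ltW s0les] := leP s s0.
    have sl : (s / s0 <= 1)%R by rewrite ler_pdivrMr// mul1r.
    apply: (@le_trans _ _ (s `^ (- theta) * (2 * C * phi t * (s / s0)))%:E).
      by rewrite EFinM lee_wpmul2l ?K3// lee_fin powR_ge0.
    rewrite lee_fin sdec//.
    have hb : ((s / s0) `^ (- theta) * (s / s0) <= bump e s0 s)%R.
      rewrite -{2}(powRr1 (ltW ss0)) -powRD ?(gt_eqF ss0) ?implybT//.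
      rewrite /bump le_min; apply/andP; split; apply: ger_powR; rewrite ?ss0//; lra.
    rewrite (_ : _ * _ = C * phi t / t * (2 * ((s / s0) `^ (- theta) * (s / s0))))%R; last by ring.
    by rewrite -[leRHS]mulrA ler_pM2l//; lra.
  have sl : (1 <= s / s0)%R by rewrite ler_pdivlMr// mul1r.
  have hb0 : ((s / s0) `^ (- theta) <= bump e s0 s)%R.
    by rewrite /bump le_min; apply/andP; split; apply: ler_powR => //; lra.
  have [s1|/ltW s1] := leP s 1%R.
    apply: (@le_trans _ _ (s `^ (- theta) * (C * phi t * (3 + s `^ alpha / t)))%:E).
      by rewrite EFinM lee_wpmul2l ?K1 ?sp// lee_fin powR_ge0.
    have hb1 : (s `^ (- theta) * s `^ alpha <= bump e 1 s)%R.
      rewrite -powRD ?(gt_eqF sp) ?implybT// /bump divr1 le_min.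
      by apply/andP; split; apply: ger_powR; rewrite ?sp//; lra.
    rewrite lee_fin (_ : _ * _ = C * phi t / t * (3 * (t * s `^ (- theta)) + s `^ (- theta) * s `^ alpha))%R; last first.
      by field; rewrite gt_eqF.
    by rewrite -[leRHS]mulrA ler_pM2l// tS; lra.
  apply: (@le_trans _ _ (s `^ (- theta) * (C * phi t * (2 + t^-1)))%:E).
    by rewrite EFinM lee_wpmul2l ?K2// lee_fin powR_ge0.
  have hb1 : (s `^ (- theta) <= bump e 1 s)%R.
    by rewrite /bump divr1 le_min; apply/andP; split; apply: ler_powR => //; lra.
  rewrite lee_fin (_ : _ * _ = C * phi t / t * (2 * (t * s `^ (- theta)) + s `^ (- theta)))%R; last first.
    by field; rewrite gt_eqF.
  by rewrite -[leRHS]mulrA ler_pM2l// tS; lra.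
apply: (le_trans (Kfun_le_dec t xE h0 _)).
  by apply: (le_lt_trans main); rewrite ltry.
apply: (le_trans (leeD hx0 (lee_wpmul2l _ main))); first by rewrite lee_fin ltW.
rewrite -EFinM -EFinD lee_fin le_eqVlt; apply/orP; left; apply/eqP.
by field; rewrite gt_eqF.
Qed.

End dilation.

(** * Square roots of the variable and null sets *)

Section square_root_null.
Context {R : realType}.
Local Open Scope ereal_scope.
Notation mu := (@lebesgue_measure R).

Lemma sqrt_I01 (t : R) : @I01 R t -> @I01 R (Num.sqrt t).
Proof.
move=> /I01E/andP[t0 t1]; apply/I01E.
by rewrite sqrtr_ge0/= -sqrtr1 ler_sqrt.
Qed.

Lemma measurable_sqrt_I01 : measurable_fun (@I01 R) (@Num.sqrt R).
Proof.
apply: monotone_measurable_I01 => s t s0 st _.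
by rewrite ler_sqrt// (le_trans s0).
Qed.

Lemma measurable_comp_sqrt (f : R -> R) : measurable_fun (@I01 R) f ->
  measurable_fun (@I01 R) (fun t => f (Num.sqrt t)).
Proof.
move=> mf; apply: (@measurable_comp _ _ _ _ _ _ (@I01 R)) => //.
- exact: measurable_itv.
- by move=> _ [t It <-]; exact: sqrt_I01.
- exact: measurable_sqrt_I01.
Qed.

(** After clamping, the preimage lies between [a'^2] and [b'^2], and squaring is 2-Lipschitz on
    [[0, 1]]. *)
Lemma sqrt_preimage_ocitv (a b : R) : (a <= b)%R ->
  mu (@I01 R `&` Num.sqrt @^-1` `]a, b]%classic) <= 2%:E * (b - a)%:E.
Proof.
move=> ab; pose a' := (Num.max a 0)%R; pose b' := (Num.max 0 (Num.min b 1))%R.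
have sub : @I01 R `&` Num.sqrt @^-1` `]a, b]%classic `<=`
    `[(a' ^+ 2)%R, (b' ^+ 2)%R]%classic.
  move=> t [/[dup] It /I01E/andP[t0 t1]] /=; rewrite !in_itv/= => /andP[at_ tb].
  have := sqrt_I01 It; move=> /I01E/andP[s0 s1].
  rewrite -{1 2}(sqr_sqrtr t0) !ler_pXn2r ?nnegrE// ?le_max ?lexx ?orbT//.
  by rewrite ge_max (ltW at_) s0/= orbC le_min tb s1.
have mB : measurable (@I01 R `&` Num.sqrt @^-1` `]a, b]%classic).
  by apply: measurable_sqrt_I01; exact: measurable_itv.
apply: (@le_trans _ _ (mu `[(a' ^+ 2)%R, (b' ^+ 2)%R]%classic)).
  by apply: le_measure => //; rewrite inE.
rewrite lebesgue_measure_itv/= lte_fin; case: ifPn => [h|_]; last first.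
  by rewrite -EFinM lee_fin mulr_ge0// subr_ge0.
rewrite -EFinD -EFinM lee_fin.
have a'0 : (0 <= a')%R by rewrite le_max lexx orbT.
have b'0 : (0 <= b')%R by rewrite le_max lexx.
have a'b' : (a' < b')%R by move: h; rewrite ltr_pXn2r.
have b'1 : (b' <= 1)%R by rewrite ge_max ler01/= ge_min lexx orbT.
have aa' : (a <= a')%R by rewrite le_max lexx.
have b'b : (b' <= b)%R.
  move: a'b'; rewrite {1}/b' /b' lt_max; have [h0|h0] := leP (Num.min b 1)%R 0%R.
    by rewrite ltNge a'0/= => h1; move: (lt_le_trans h1 h0); rewrite ltNge a'0.
  by move=> _; rewrite ge_min lexx.
nra.
Qed.

(** This makes [f(sqrt t)] depend only on the class of [f]. A null set is covered by half-open
    intervals of total length below [e / 2], and their preimages have total measure at most [e]. *)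
Lemma ae_sqrt (P : R -> Prop) : {ae mu, forall t, @I01 R t -> P t} ->
  {ae mu, forall t, @I01 R t -> P (Num.sqrt t)}.
Proof.
move=> [A [mA A0 PA]].
pose B := @I01 R `&` Num.sqrt @^-1` A.
have mB : measurable B by apply: measurable_sqrt_I01; [exact: measurable_itv|].
exists B; split => //; last first.
  move=> t /= h; rewrite /B; apply: contrapT => nB; apply: h => It.
  apply: contrapT => nP; apply: nB; split => //=; apply: PA => /= h2; apply: nP.
  by apply: h2; exact: sqrt_I01.
apply/eqP; rewrite eq_le measure_ge0 andbT; apply/lee_addgt0Pr => e e0; rewrite add0e.
have /ereal_inf_lt[z [/= M' covAM sMz zDe]] : mu A < (e / 2)%:E.
  by rewrite A0 lte_fin divr_gt0.
pose F n := @I01 R `&` Num.sqrt @^-1` (M' n).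
have FE n : measurable (F n) /\ mu (F n) <= 2%:E * wlength idfun (M' n).
  have : ocitv (M' n) by case: covAM => /(_ n).
  rewrite /F => /ocitvP[->|[[a b] /= ab ->]].
    by rewrite preimage_set0 setI0 measure0 wlength0 mule0; split => //; exact: measurable0.
  rewrite wlength_itv_bnd ?(ltW ab)//; split; last exact: sqrt_preimage_ocitv (ltW ab).
  by apply: measurable_sqrt_I01; exact: measurable_itv.
have BF : B `<=` \bigcup_n F n.
  move=> t [It /= At]; case: covAM => _ /(_ _ At)[n _ Mn].
  by exists n.
have := @measure_sigma_subadditive _ _ _ (@lebesgue_measure R) B F (fun n => (FE n).1) mB BF.
move/le_trans; apply.
apply: (@le_trans _ _ (\sum_(n <oo) (2%:E * wlength idfun (M' n)))).
  by apply: lee_nneseries => [n _ _|n _]; [exact: measure_ge0|exact: (FE n).2].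
rewrite nneseriesZl; last by move=> n _; exact: wlength_ge0.
rewrite sMz; apply: (@le_trans _ _ (2%:E * (e / 2)%:E)).
  by rewrite lee_wpmul2l// ltW.
by rewrite -EFinM lee_fin mulrC divfK.
Qed.
End square_root_null.

Section Linfty.
Context {R : realType}.
Implicit Types f g : R -> R.
Local Open Scope ereal_scope.
Notation mu := (@lebesgue_measure R).

Lemma Lp_ge0 p f : 0 <= Lp p f.
Proof. by rewrite /Lp; case: ifP => // _; exact: Lnorm_ge0. Qed.

Lemma Lp_measurable p f : Lp p f < +oo -> measurable_fun (@I01 R) f.
Proof. by rewrite /Lp; case: asboolP. Qed.

Lemma lebesgue_measure_setT_gt0 : 0 < mu [set: R].
Proof.
apply: (@lt_le_trans _ _ (mu `]0%R, 1%R]%classic)).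
  by rewrite lebesgue_measure_itv/= lte_fin ltr01 oppr0 adde0.
by apply: le_measure; rewrite ?inE//; exact: measurable_itv.
Qed.

Lemma LinftyP f (M : R) : (0 <= M)%R -> Lp +oo f <= M%:E <->
  measurable_fun (@I01 R) f /\ {ae mu, forall t, @I01 R t -> (`|f t| <= M)%R}.
Proof.
move=> M0; rewrite /Lp; case: asboolP => mf; last by split => [|[]//]; rewrite leye_eq.
rewrite unlock lebesgue_measure_setT_gt0.
split=> [/ess_supP h|[_ h]]; [split => //|apply/ess_supP].
  apply: filterS h => t h It; move: h.
  by rewrite /= /patch mem_set// lee_fin.
apply: filterS h => t h /=; rewrite /patch; case: ifPn => [|_].
  by rewrite inE => It; rewrite lee_fin h.
by rewrite normr0 lee_fin.
Qed.

Lemma Linfty_fin f : Lp +oo f < +oo -> exists2 M : R, (0 <= M)%R & Lp +oo f = M%:E.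
Proof.
move=> h; exists (fine (Lp +oo f)); first by rewrite fine_ge0// Lp_ge0.
by rewrite fineK// ge0_fin_numE// Lp_ge0.
Qed.

End Linfty.

(** * From two equal interpolation spaces to square roots, given majorants *)

Section dilation_lattice.
Context {R : realType}.
Variable G : (R -> R) -> \bar R.
Hypothesis hG : banach_lattice G.
Local Open Scope ereal_scope.
Notation mu := (@lebesgue_measure R).

Section pair.
Context {V : lmodType R}.
Variables N0 N1 : V -> \bar R.
Hypothesis hN : ordered_norms N0 N1.
Hypothesis hR : realizing N0 N1.

Lemma Kspace_dilation (theta1 theta2 c : R) (q1 q2 : \bar R) :
  (0 < theta1)%R -> (theta1 < theta2)%R -> (theta2 < 1)%R -> 1 <= q1 -> 1 <= q2 ->
  (0 < c)%R ->
  (forall x, Kspace G N0 (real_interp N0 N1 theta2 q2) x <=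
    c%:E * Kspace G N0 (real_interp N0 N1 theta1 q1) x) ->
  exists d C : R, [/\ (0 < d < 1)%R, (0 <= C)%R & forall phi, quasiconcave phi ->
    vanishing phi -> G (fun t => phi (t `^ d)%R) <= C%:E * G phi].
Proof.
move=> th10 th12 th21 q11 q21 c0 hc.
have th1 : (0 < theta1 < 1)%R by rewrite th10 (lt_trans th12).
have th20 := lt_trans th10 th12; have th2 : (0 < theta2 < 1)%R by rewrite th20.
pose alpha := ((theta1 + theta2) / 2)%R.
have tha : (theta1 < alpha < 1)%R by rewrite /alpha; lra.
have alt : (alpha < theta2)%R by rewrite /alpha; lra.
have alpha0 : (0 < alpha)%R by case/andP: tha => + _; exact: lt_trans.
have [C C0 hC] := hR.
have [D D0 hD] := Kfun_interp_le_quasiconcave hN th1 tha C0 q11.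
exists (alpha / theta2)%R, (4 * C * (c * D))%R.
split; first by rewrite divr_gt0//= ltr_pdivrMr ?mul1r.
  by rewrite !mulr_ge0// ltW.
move=> phi qphi vphi; pose psi s := phi (s `^ alpha)%R.
have alpha1 : (0 < alpha <= 1)%R by rewrite alpha0 ltW//; case/andP: tha.
have qpsi : quasiconcave psi by exact: quasiconcave_powR.
have vpsi : vanishing psi by exact: vanishing_powR.
have [x N0x hx] := hC psi qpsi vpsi.
have k0 theta q t : (1 <= q) -> (0 <= t)%R ->
    (0 <= fine (Kfun N0 (real_interp N0 N1 theta q) t x))%R.
  move=> hq t0; rewrite fine_ge0// Kfun_ge0//; first exact: (onorm_ge0 hN).
  by move=> y; exact: (interp_ge0 hN).
pose k theta q t := fine (Kfun N0 (real_interp N0 N1 theta q) t x).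
(* [phi(t^(alpha/theta2))] is [psi(t^(1/theta2))], so at most [C K(t^(1/theta2), x)], and
   [Kfun_le_Kfun_interp] at that point returns to [K_theta2(t, x)]. *)
have step1 : G (fun t => phi (t `^ (alpha / theta2))%R) <= (4 * C)%:E * G (k theta2 q2).
  apply: (lattice_leM_pointwise hG); first by rewrite mulr_ge0// ltW.
    apply: measurable_quasiconcave; apply: quasiconcave_powR => //.
    by rewrite divr_gt0//= ler_pdivrMr ?mul1r// ltW.
  move=> t t01; have /andP[t0 t1] := t01.
  have s01 : (0 < t `^ theta2^-1 <= 1)%R by apply: powR_I01; rewrite // invr_ge0 ltW.
  have [h _] := hx _ s01; have /andP[s0 _] := s01.
  rewrite ger0_norm; last first.
    by rewrite ltW// (qc_gt0 qphi)// powR_I01// divr_ge0// ltW.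
  rewrite ger0_norm ?k0 ?(ltW t0)//.
  have -> : phi (t `^ (alpha / theta2))%R = psi (t `^ theta2^-1)%R.
    by rewrite /psi -powRrM mulrC.
  rewrite -lee_fin EFinM /k fineK ?(Kfun_interp_fin_num hN) ?(ltW t0)//.
  apply: (le_trans h); rewrite (mulrC 4%R) EFinM -muleA lee_wpmul2l ?lee_fin ?(ltW C0)//.
  apply: (le_trans (Kfun_le_Kfun_interp hN th2 q21 x s0)).
  by rewrite -powRrM mulVf ?gt_eqF// powRr1// ltW.
have step2 : G (k theta2 q2) <= c%:E * G (k theta1 q1).
  by have := hc x; rewrite !(Kspace_interp G hN).
have step3 : G (k theta1 q1) <= D%:E * G phi.
  apply: (lattice_leM_pointwise hG); first exact: ltW.
    exact: (measurable_Kfun_interp hN).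
  move=> t t01; have /andP[t0 t1] := t01.
  rewrite ger0_norm ?k0 ?(ltW t0)// ger0_norm; last by rewrite ltW// (qc_gt0 qphi).
  rewrite -lee_fin /k fineK ?(Kfun_interp_fin_num hN) ?(ltW t0)//.
  apply: hD => // s s01; exact: (hx s s01).2.
apply: (le_trans step1); rewrite [X in _ <= X * _]EFinM -muleA.
rewrite lee_wpmul2l ?lee_fin ?mulr_ge0 ?(ltW C0)//.
apply: (le_trans step2); rewrite EFinM -muleA lee_wpmul2l ?lee_fin ?(ltW c0)//.
Qed.

End pair.

(** Each iterate is again quasi-concave and vanishing, so the bound compounds to [C^n]. Once
    [d^n <= 1/2], [sqrt t <= t^(d^n)] on [[0, 1]] and monotonicity of [phi] finishes. *)
Lemma dilation_iter (d C : R) : (0 < d < 1)%R -> (0 <= C)%R ->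
  (forall phi, quasiconcave phi -> vanishing phi ->
    G (fun t => phi (t `^ d)%R) <= C%:E * G phi) ->
  exists2 D : R, (0 <= D)%R & forall phi, quasiconcave phi -> vanishing phi ->
    G (fun t => phi (Num.sqrt t)) <= D%:E * G phi.
Proof.
move=> /andP[d0 d1] C0 hC.
have dn n : (0 < d ^+ n <= 1)%R by rewrite exprn_gt0//= exprn_ile1// ltW.
have iter n phi : quasiconcave phi -> vanishing phi ->
    G (fun t => phi (t `^ (d ^+ n))%R) <= (C ^+ n)%:E * G phi.
  move=> qphi vphi; elim: n => [|n IH].
    rewrite expr0 expr0; apply: (lattice_leM_pointwise hG) => //.
      by apply: measurable_quasiconcave; apply: quasiconcave_powR => //; rewrite ltr01 lexx.
    by move=> t /andP[t0 _]; rewrite mul1r powRr1// ltW.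
  pose psi t := phi (t `^ (d ^+ n))%R.
  have -> : (fun t => phi (t `^ (d ^+ n.+1))%R) = (fun t => psi (t `^ d)%R).
    by apply/funext => t; rewrite /psi -powRrM exprS.
  apply: (le_trans (hC _ _ _)); first exact: quasiconcave_powR.
    by apply: vanishing_powR => //; case/andP: (dn n).
  by rewrite exprS EFinM -muleA lee_wpmul2l ?lee_fin.
have [n hn] : exists n : nat, (d ^+ n <= 2^-1)%R.
  have : (d ^+ n)%R @[n --> \oo] --> (0:R)%R.
    by apply: cvg_expr; rewrite ger0_norm// ltW.
  move/cvgrPdist_le => /(_ (2^-1)%R); rewrite invr_gt0 ltr0n => /(_ isT).
  move=> [n _ /(_ n (leqnn n))].
  by rewrite sub0r normrN ger0_norm ?exprn_ge0 ?(ltW d0)// => h; exists n.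
exists (C ^+ n)%R; first exact: exprn_ge0.
move=> phi qphi vphi; apply: le_trans (iter n phi qphi vphi).
rewrite -[leRHS]mul1e; apply: (lattice_leM_pointwise hG) => //.
  by apply: measurable_comp_sqrt; exact: measurable_quasiconcave.
move=> t t01; have /andP[t0 t1] := t01; rewrite mul1r -powR12_sqrt ?(ltW t0)//.
have /andP[a0 a1] : (0 < t `^ 2^-1 <= 1)%R by exact: powR_I01.
have /andP[b0 b1] : (0 < t `^ (d ^+ n) <= 1)%R.
  by apply: powR_I01 => //; rewrite exprn_ge0// ltW.
rewrite ger0_norm; last by rewrite ltW// (qc_gt0 qphi)// a0.
rewrite ger0_norm; last by rewrite ltW// (qc_gt0 qphi)// b0.
by apply: (qc_nd qphi) => //; [exact: ltW|apply: ger_powR; rewrite ?t0].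
Qed.

(** Norm 0 is excluded because a quasi-concave function is positive on []0, 1]] and so has positive
    norm. *)
Definition has_majorants := exists2 C : R, (0 <= C)%R & forall f, 0 < G f < +oo ->
  exists phi, [/\ quasiconcave phi, G phi <= C%:E * G f &
    {ae mu, forall t, @I01 R t -> (`|f t| <= phi t)%R}].

Lemma sqrt_bounded_majorant (D : R) : embedded G (Lp +oo) -> has_majorants ->
  (0 <= D)%R -> (forall phi, quasiconcave phi -> vanishing phi ->
    G (fun t => phi (Num.sqrt t)) <= D%:E * G phi) ->
  bounded_on G (fun f t => f (Num.sqrt t)).
Proof.
move=> [E hE] [C C0 hC] D0 hD.
(* Functions of norm 0 are outside [has_majorants]; they vanish almost everywhere, and so do their
   compositions with the square root. *)
have G0 f : G f = 0 -> G (fun t => f (Num.sqrt t)) <= 0.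
  move=> f0; have mf : measurable_fun (@I01 R) f.
    by apply: (lattice_measurable hG); rewrite f0 ltry.
  rewrite -(mul0e (G f)); apply: (lattice_leM hG) => //; first exact: measurable_comp_sqrt.
  have := ae_sqrt (lattice_eq0 hG f0); apply: filterS => t h It.
  by rewrite h// normr0 mul0r.
(* If some quasi-concave function of [G] does not vanish at 0, then [1] is in [G]. *)
have [[phi [qphi phif nv]]|nphi] := pselect (exists phi, [/\ quasiconcave phi,
    G phi < +oo & ~ vanishing phi]).
  have [e e0 he] : exists2 e : R, (0 < e)%R & forall s, (0 < s <= 1)%R -> (e <= phi s)%R.
    apply: contrapT => h; apply: nv => e e0; apply: contrapT => h2; apply: h.
    exists e => // s s01; rewrite leNgt; apply/negP => h3; apply: h2.
    by exists s.
  have G1 : G (cst 1%R) < +oo.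
    have : G (cst 1%R) <= (e^-1)%:E * G phi.
      apply: (lattice_leM_pointwise hG); first by rewrite invr_ge0 ltW.
        exact: measurable_cst.
      move=> t t01; rewrite normr1 ler_pdivlMl// mulr1 (le_trans (he t t01))//.
      exact: ler_norm.
    by move/le_lt_trans; apply; rewrite lte_mul_pinfty// ?lee_fin ?invr_ge0 ?(ltW e0)// (lattice_ge0 hG).
  have G1f : G (cst 1%R) \is a fin_num by rewrite ge0_fin_numE// (lattice_ge0 hG).
  exists (Num.max 0 E * fine (G (cst 1%R)))%R => f Gf.
  have Gff : G f \is a fin_num by rewrite ge0_fin_numE// (lattice_ge0 hG).
  pose M := (Num.max 0 E * fine (G f))%R.
  have M0 : (0 <= M)%R by rewrite mulr_ge0 ?le_max ?lexx// fine_ge0// (lattice_ge0 hG).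
  have /(LinftyP _ M0)[mf hf] : Lp +oo f <= M%:E.
    apply: (le_trans (hE f Gf)); rewrite /M EFinM fineK//.
    by rewrite lee_wpmul2r ?(lattice_ge0 hG)// lee_fin le_max lexx orbT.
  (* The embedding into [L^oo] bounds [|f|], hence also [|f(sqrt t)|], by a multiple of the constant
     1, which has finite norm here. *)
  apply: (@le_trans _ _ (M%:E * G (cst 1%R))).
    apply: (lattice_leM hG) => //; first exact: measurable_comp_sqrt.
    by have := ae_sqrt hf; apply: filterS => t h It; rewrite normr1 mulr1 h.
  by rewrite /M !EFinM !fineK// -!muleA (muleC (G f)).
exists (D * C)%R => f Gf; have [f0|f0] := eqVneq (G f) 0.
  by rewrite f0 mule0 G0.
have Gfpos : 0 < G f < +oo by rewrite Gf lt_neqAle eq_sym f0 (lattice_ge0 hG).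
have [phi [qphi Gphi hphi]] := hC f Gfpos.
have phif : G phi < +oo by rewrite (le_lt_trans Gphi)// lte_mul_pinfty ?lee_fin ?(lattice_ge0 hG).
have vphi : vanishing phi by apply: contrapT => nv; apply: nphi; exists phi.
apply: (@le_trans _ _ (G (fun t => phi (Num.sqrt t)))).
  rewrite -[leRHS]mul1e; apply: (lattice_leM hG) => //.
    by apply: measurable_comp_sqrt; exact: (lattice_measurable hG).
  have := ae_sqrt hphi; apply: filterS => t h It.
  by rewrite mul1r (le_trans (h It))// ler_norm.
apply: (le_trans (hD _ qphi vphi)).
by rewrite EFinM -muleA lee_wpmul2l ?lee_fin.
Qed.

End dilation_lattice.

(** * Quasi-concave majorants *)

Section dyadic.
Context {R : realType}.
Implicit Types (t : R) (k : nat).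

Definition dy k : R := 2^-1 ^+ k.

Lemma dy_gt0 k : 0 < dy k. Proof. by rewrite exprn_gt0// invr_gt0. Qed.

Lemma dyS k : dy k.+1 = dy k / 2. Proof. by rewrite /dy exprSr. Qed.

Lemma dy_le1 k : dy k <= 1.
Proof. by rewrite exprn_ile1// invf_le1// ler1n. Qed.

Lemma dy_anti j k : (j <= k)%N -> dy k <= dy j.
Proof.
by move=> jk; apply: ler_wiXn2l => //; rewrite invf_le1// ler1n.
Qed.

Definition dyD k : set R := `]dy k.+1, dy k]%classic.

Lemma measurable_dyD k : measurable (dyD k). Proof. exact: measurable_itv. Qed.

Lemma dyDE k t : dyD k t <-> dy k.+1 < t <= dy k.
Proof. by rewrite /dyD/= in_itv. Qed.

Lemma dyD_gt0 k t : dyD k t -> 0 < t <= 1.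
Proof.
by move=> /dyDE/andP[/(lt_trans (dy_gt0 _)) -> /le_trans]/=; apply; exact: dy_le1.
Qed.

Lemma dyD_I01 k : dyD k `<=` @I01 R.
Proof. by move=> t /dyD_gt0/andP[/ltW t0 t1]; apply/I01E; rewrite t0. Qed.

Lemma dyD_exists t : 0 < t <= 1 -> exists k, dyD k t.
Proof.
move=> /andP[t0 t1].
have h : exists n, (dy n < t).
  have t2 : 0 < t / 2 by rewrite divr_gt0.
  have [n nt] := half_expn_le t2; exists n; rewrite (le_lt_trans nt)//.
  by rewrite ltr_pdivrMr// ltr_pMr// ltr1n.
case: (ex_minnP h) => -[|k] kt hmin.
  by move: kt; rewrite /dy expr0 => /lt_le_trans/(_ t1); rewrite ltxx.
exists k; apply/dyDE; rewrite kt/= leNgt; apply/negP => /hmin.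
by rewrite ltnn.
Qed.

Lemma dyD_inj j k t : dyD j t -> dyD k t -> j = k.
Proof.
wlog jk : j k / (j <= k)%N.
  by move=> w; case: (leqP j k) => [|/ltnW] jk h1 h2; [exact: w|apply/esym/w].
move=> /dyDE/andP[jt _] /dyDE/andP[_ tk].
apply/eqP; rewrite eqn_leq jk/= leqNgt; apply/negP => /dy_anti h.
by have := lt_le_trans jt (le_trans tk h); rewrite ltxx.
Qed.

Definition dyidx t : nat := xget 0%N [set k | dyD k t].

Lemma dyidxP t : 0 < t <= 1 -> dyD (dyidx t) t.
Proof.
move=> /dyD_exists[k kt]; rewrite /dyidx.
by have := @xgetPex _ 0%N [set k | dyD k t]; apply; exists k.
Qed.

Lemma dyidxE k t : dyD k t -> dyidx t = k.
Proof. by move=> kt; apply: (@dyD_inj _ _ t) => //; apply: dyidxP; exact: dyD_gt0 kt. Qed.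

Lemma bigcup_dyD : \bigcup_k dyD k = [set t | 0 < t <= 1].
Proof.
apply/seteqP; split=> [t [k _]|t /= /dyD_exists[k kt]]; first exact: dyD_gt0.
by exists k.
Qed.

Lemma measurable_I01_dyD (f : R -> R) : (forall k, measurable_fun (dyD k) f) ->
  measurable_fun (@I01 R) f.
Proof.
move=> mf; have -> : @I01 R = [set 0] `|` \bigcup_k dyD k.
  rewrite bigcup_dyD; apply/seteqP; split=> [t /I01E/andP[]|t].
    rewrite le_eqVlt => /predU1P[<- _|t0 t1]; first by left.
    by right; rewrite /= t0.
  by move=> [->|/= /andP[/ltW t0 t1]]; apply/I01E; rewrite ?lexx ?ler01// t0.
apply/measurable_funU; [exact: measurable_set1| |].
  by apply: bigcup_measurable => k _; exact: measurable_dyD.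
split; first exact: measurable_fun_set1.
by apply/measurable_fun_bigcup => // k; exact: measurable_dyD.
Qed.

Lemma measurable_dystep (a : nat -> R) :
  measurable_fun (@I01 R) (fun t => a (dyidx t)).
Proof.
apply: measurable_I01_dyD => k; apply: (eq_measurable_fun (cst (a k))).
  by move=> t; rewrite inE => /dyidxE ->.
exact: measurable_cst.
Qed.

Section hull.
Variables (c : nat -> R) (M : R).
Hypothesis cM : forall k, 0 <= c k <= M.

(** When some [c k] is positive, the least quasi-concave function whose value at each [2^-k] is at
    least [c k]. *)
Definition dyhull t : R := sup [set Num.min 1 (t / dy k) * c k | k in setT].

Let has_sup_hull t : 0 <= t -> has_sup [set Num.min 1 (t / dy k) * c k | k in setT].
Proof.
move=> t0; split; first by exists (Num.min 1 (t / dy 0) * c 0%N), 0%N.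
exists M => _ [k _ <-]; have /andP[c0 cm] := cM k; apply: le_trans cm.
by rewrite ler_piMl// ge_min lexx.
Qed.

Lemma dyhull_ge t k : 0 <= t -> Num.min 1 (t / dy k) * c k <= dyhull t.
Proof.
move=> t0; apply: ub_le_sup; first by case: (has_sup_hull t0).
by exists k.
Qed.

Lemma dyhull_le t (y : R) : 0 <= t ->
  (forall k, Num.min 1 (t / dy k) * c k <= y) -> dyhull t <= y.
Proof.
move=> t0 h; apply: ge_sup; first by case: (has_sup_hull t0).
by move=> _ [k _ <-].
Qed.

Lemma dyhull_adherent t (e : R) : 0 <= t -> 0 < e -> exists k,
  dyhull t - e < Num.min 1 (t / dy k) * c k.
Proof.
move=> t0 e0; have [_ [k _ <-] h] := sup_adherent e0 (has_sup_hull t0).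
by exists k.
Qed.

(** Each [min(1, t / 2^-k)] is nondecreasing and becomes nonincreasing after division by [t]; both
    properties survive nonnegative multiples and suprema. *)
Lemma quasiconcave_dyhull k0 : 0 < c k0 -> quasiconcave dyhull.
Proof.
move=> ck0.
have w0 t k : 0 <= t -> 0 <= Num.min 1 (t / dy k).
  by move=> t0; rewrite le_min ler01 divr_ge0// ltW// dy_gt0.
have c0 k : 0 <= c k by case/andP: (cM k).
split.
- apply: le_trans (dyhull_ge k0 (lexx 0)).
  by rewrite mulr_ge0// w0.
- move=> t /andP[t0 t1]; apply: lt_le_trans (dyhull_ge k0 (ltW t0)).
  by rewrite mulr_gt0// lt_min ltr01 divr_gt0// dy_gt0.
- move=> s t s0 st t1; have t0 := le_trans s0 st.
  apply: dyhull_le => // k; apply: le_trans (dyhull_ge k t0).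
  rewrite ler_wpM2r// le_min !ge_min lexx/=.
  by rewrite ler_pM2r ?invr_gt0 ?dy_gt0// st orbT.
- move=> s t s0 st t1; have t0 := lt_le_trans s0 st.
  rewrite mulrC -ler_pdivlMr//; apply: dyhull_le => [|k]; first exact: ltW.
  rewrite ler_pdivlMr//.
  apply: (@le_trans _ _ (t * (Num.min 1 (s / dy k) * c k))); last first.
    by rewrite ler_pM2l// dyhull_ge// ltW.
  rewrite mulrAC mulrA ler_wpM2r//.
  have d0 := dy_gt0 k.
  have [h|/ltW h] := leP 1 (s / dy k).
    by rewrite mulr1 (le_trans _ st)// ler_piMl ?(ltW s0)// ge_min lexx.
  rewrite [leRHS]mulrCA mulrC ler_pM2l// -[leRHS]/(t / dy k).
  by rewrite ge_min lexx orbT.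
Qed.

End hull.
End dyadic.

Section average.
Context {R : realType}.
Notation mu := (@lebesgue_measure R).
Variable E : set R.
Hypothesis mE : measurable E.
Hypothesis Efin : (mu E < +oo)%E.
Implicit Types f g : R -> R.

(** On a null set the convention [0^-1 = 0] makes the average 0, so linearity and [avg_le] hold for
    null sets as well. *)
Definition avg g : R := (fine (mu E))^-1 * (\int[mu]_(x in E) g x).

Let muE : mu E = (fine (mu E))%:E.
Proof. by rewrite fineK// ge0_fin_numE. Qed.

Let muE0 : 0 <= fine (mu E). Proof. by rewrite fine_ge0. Qed.

Lemma integral_ae_bound g (M : R) : 0 <= M -> measurable_fun E g ->
  {ae mu, forall t, E t -> `|g t| <= M} ->
  (\int[mu]_(x in E) `|(g x)%:E| <= M%:E * mu E)%E.
Proof.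
move=> M0 mg hg; rewrite -integral_cst//; apply: ae_ge0_le_integral => //.
- by apply/measurable_EFinP; exact: measurableT_comp.
Qed.

Lemma integrable_ae_bound g (M : R) : 0 <= M -> measurable_fun E g ->
  {ae mu, forall t, E t -> `|g t| <= M} -> mu.-integrable E (EFin \o g).
Proof.
move=> M0 mg hg; apply/integrableP; split; first exact/measurable_EFinP.
apply: le_lt_trans (integral_ae_bound M0 mg hg) _.
by rewrite muE -EFinM ltry.
Qed.

Lemma avg_le g (M : R) : 0 <= M -> measurable_fun E g ->
  {ae mu, forall t, E t -> `|g t| <= M} -> `|avg g| <= M.
Proof.
move=> M0 mg hg; have ig := integrable_ae_bound M0 mg hg.
rewrite /avg normrM ger0_norm ?invr_ge0//.
have h : `|\int[mu]_(x in E) g x| <= M * fine (mu E).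
  rewrite -lee_fin EFin_normr_Rintegral//.
  apply: (le_trans (le_abse_integral _ _ _)) => //; first exact/measurable_EFinP.
  by rewrite EFinM -muE; exact: integral_ae_bound.
have [e0|e0] := eqVneq (fine (mu E)) 0.
  by rewrite e0 invr0 mul0r.
rewrite mulrC ler_pdivrMr// lt_neqAle eq_sym e0//.
Qed.

Lemma avg_ge g (c M : R) : 0 <= M -> measurable_fun E g ->
  {ae mu, forall t, E t -> `|g t| <= M} -> (forall t, E t -> c <= g t) ->
  (0 < mu E)%E -> c <= avg g.
Proof.
move=> M0 mg hg hc E0; have ig := integrable_ae_bound M0 mg hg.
have e0 : 0 < fine (mu E) by rewrite fine_gt0// E0 Efin.
rewrite /avg mulrC ler_pdivlMr// -(Rintegral_cst mu mE).
apply: le_Rintegral => //.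
by apply: (@integrable_ae_bound _ `|c|) => //; apply: aeW.
Qed.

Lemma avg_linear (a : R) f g (M N : R) : 0 <= M -> 0 <= N ->
  measurable_fun E f -> measurable_fun E g ->
  {ae mu, forall t, E t -> `|f t| <= M} -> {ae mu, forall t, E t -> `|g t| <= N} ->
  avg (a *: f + g) = a * avg f + avg g.
Proof.
move=> M0 N0 mf mg hf hg.
have jf := integrable_ae_bound M0 mf hf; have jg := integrable_ae_bound N0 mg hg.
rewrite /avg mulrCA -mulrDr; congr (_ * _).
rewrite -RintegralZl// -RintegralD//.
apply: (@integrable_ae_bound (fun t => a * f t) (`|a| * M)).
- by rewrite mulr_ge0.
- by apply: measurable_funM => //; exact: measurable_cst.
- by apply: filterS hf => t h Et; rewrite normrM ler_wpM2l// h.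
Qed.

End average.

(** * A quasi-concave majorant for a single function *)

Section majorant.
Context {R : realType}.
Variable G : (R -> R) -> \bar R.
Hypothesis hG : interpolation_lattice G.
Notation mu := (@lebesgue_measure R).
Let hB := interpolation_banach hG.
Implicit Types f g : R -> R.

Lemma ae_sub_dyD k (P : R -> Prop) : {ae mu, forall t, @I01 R t -> P t} ->
  {ae mu, forall t, dyD k t -> P t}.
Proof. by apply: filterS => t h Dt; apply: h; exact: dyD_I01 Dt. Qed.

Lemma mu_dyD_fin k (E : set R) : measurable E -> E `<=` dyD k -> (mu E < +oo)%E.
Proof.
move=> mE ED; apply: (@le_lt_trans _ _ (mu (@dyD R k))).
  by apply: le_measure => //; rewrite inE//; exact: measurable_dyD.
rewrite lebesgue_measure_itv/= lte_fin; case: ifP => _; rewrite ?ltry//.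
Qed.

Lemma ae_dyD (P : R -> Prop) : (forall k, {ae mu, forall t, dyD k t -> P t}) ->
  {ae mu, forall t, @I01 R t -> P t}.
Proof.
move=> /ae_foralln h.
have h0 : {ae mu, forall t : R, @I01 R t -> 0 < t <= 1} by exact: ae_I01.
apply: filterS2 h h0 => t h1 h2 It; have t01 := h2 It.
by apply: (h1 (dyidx t)); exact: dyidxP.
Qed.

Section operator.
Variables (E : nat -> set R) (w : nat -> R) (kk : nat -> nat).
Hypothesis mE : forall k, measurable (E k).
Hypothesis ED : forall k, E k `<=` dyD k.
Hypothesis w0 : forall j, 0 <= w j <= 1.
Hypothesis wk : forall j, w j * dy (kk j) <= dy j.

(* The conditions on [w] make this bounded on both end spaces, for any choice of
   the index map [kk]. *)
Definition dyop g : R -> R := fun t => w (dyidx t) * avg (E (kk (dyidx t))) g.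

Let Efin k := mu_dyD_fin (mE k) (@ED k).

Let mfE k g : measurable_fun (@I01 R) g -> measurable_fun (E k) g.
Proof.
by apply: measurable_funS; [exact: measurable_itv|exact: subset_trans (@ED k) (@dyD_I01 R k)].
Qed.

Let aeE k (P : R -> Prop) : {ae mu, forall t, @I01 R t -> P t} ->
  {ae mu, forall t, E k t -> P t}.
Proof. by apply: filterS => t h Et; apply: h; apply: dyD_I01; exact: ED Et. Qed.

Lemma dyop_linear : linear_on_Linf dyop.
Proof.
move=> a f g /Linfty_fin[M M0 fM] /Linfty_fin[N N0 gN].
have /(LinftyP _ M0)[mf hf] : (Lp +oo f <= M%:E)%E by rewrite fM.
have /(LinftyP _ N0)[mg hg] : (Lp +oo g <= N%:E)%E by rewrite gN.
apply: aeW => t _; rewrite /dyop (avg_linear _ _ _ M0 N0)//; last 4 first.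
- exact: mfE.
- exact: mfE.
- exact: aeE.
- exact: aeE.
by rewrite mulrDr mulrCA.
Qed.

Lemma dyop_bounded_Linf : bounded_on (Lp +oo%E) dyop.
Proof.
exists 1 => g /Linfty_fin[N N0 gN]; rewrite gN mul1e.
have /(LinftyP _ N0)[mg hg] : (Lp +oo g <= N%:E)%E by rewrite gN.
apply/LinftyP => //; split.
  exact: (measurable_dystep (fun j => w j * avg (E (kk j)) g)).
apply: aeW => t _; rewrite /dyop normrM.
have /andP[a b] := w0 (dyidx t).
rewrite (ger0_norm a) -[leRHS]mul1r ler_pM//.
by apply: avg_le => //; [exact: mfE|exact: aeE].
Qed.

Lemma measurable_inv_I01 : measurable_fun (@I01 R) (fun t => t^-1).
Proof.
apply: (eq_measurable_fun (fun t : R => t `^ (-1))).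
  by move=> t; rewrite inE => /I01E/andP[t0 _]; rewrite powR_inv1.
by apply: measurable_funTS; exact: measurable_powR.
Qed.

(** If [|g(s)| <= N s], the average over a subset of the [k]th dyadic interval is at most [N 2^-k].
    The weight turns this into [N 2^-j], and [2^-j < 2 t] on the [j]th interval, whence the 2. *)
Lemma dyop_bounded_Linfw : bounded_on (@Linfw R) dyop.
Proof.
exists 2 => g /Linfty_fin[N N0 gN].
have /(LinftyP _ N0)[mg hg] : (Lp +oo (fun t => g t / t)%R <= N%:E)%E by rewrite gN.
rewrite /Linfw gN -EFinM; apply/LinftyP; first by rewrite mulr_ge0.
split.
  apply: measurable_funM; last exact: measurable_inv_I01.
  exact: (measurable_dystep (fun j => w j * avg (E (kk j)) g)).
apply: ae_I01 => t t01; have /andP[t0 t1] := t01.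
have Dt := dyidxP t01; set j := dyidx t in Dt *.
rewrite /dyop -/j normrM normrM normfV (gtr0_norm t0).
have /andP[a b] := w0 j; rewrite (ger0_norm a) ler_pdivrMr//.
have k0 : 0 < dy (kk j) :> R := dy_gt0 _.
have Ht : `|avg (E (kk j)) g| <= N * dy (kk j).
  have sub := @ED (kk j).
  apply: avg_le => //.
  - by rewrite mulr_ge0// ltW.
  - apply: (eq_measurable_fun (fun t => g t / t * t)).
      by move=> s; rewrite inE => /sub/dyD_gt0/andP[s0 _]; rewrite divfK// gt_eqF.
    by apply: measurable_funM => //; exact: mfE.
  - have := @aeE (kk j) _ hg; apply: filterS => s h Es.
    have := sub _ Es => /[dup] /dyD_gt0/andP[s0 _] /dyDE/andP[_ sd].
    have := h Es; rewrite normrM normfV (gtr0_norm s0) ler_pdivrMr// => /le_trans; apply.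
    by rewrite ler_wpM2l.
have := wk j; move: Dt => /dyDE/andP[]; rewrite dyS ltr_pdivrMr// => jt _ wkj.
apply: (@le_trans _ _ (w j * (N * dy (kk j)))); first by rewrite ler_wpM2l.
rewrite mulrCA; apply: (@le_trans _ _ (N * dy j)); first by rewrite ler_wpM2l.
by rewrite (mulrC 2) -mulrA ler_wpM2l// mulrC ltW.
Qed.

Lemma dyop_bounded : bounded_on G dyop.
Proof.
apply: (interpolation_bounded hG);
  [exact: dyop_linear|exact: dyop_bounded_Linf|exact: dyop_bounded_Linfw].
Qed.

End operator.

(** The majorant is the dyadic hull of twice the essential suprema [m k]. Its norm is finite because
    a multiple of [dyop] applied to [|f|] dominates it: on the [j]th interval the operator looks at
    the index [kk j] that nearly attains the hull, and averages [|f|] only where it is large. *)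
Lemma majorant_exists f : (0 < G f < +oo)%E -> exists phi,
  [/\ quasiconcave phi, (G phi < +oo)%E &
    {ae mu, forall t, @I01 R t -> `|f t| <= phi t}].
Proof.
move=> /andP[Gf0 Gf].
have [A hA] := interpolation_emb hG.
have [M M0 fM] : exists2 M : R, 0 <= M & Lp +oo f = M%:E.
  apply: Linfty_fin; apply: (le_lt_trans (hA f Gf)).
  by rewrite -(fineK (x := G f)) ?ge0_fin_numE ?(lattice_ge0 hB)// -EFinM ltry.
have /(LinftyP _ M0)[mf hf] : (Lp +oo f <= M%:E)%E by rewrite fM.
have mset k (b : R) : measurable (dyD k `&` [set t | b < `|f t|]).
  have mfk : measurable_fun (dyD k) (fun t => `|f t|).
    apply: measurableT_comp => //; apply: measurable_funS mf; first exact: measurable_itv.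
    exact: dyD_I01.
  have := mfk (measurable_dyD k) _ (measurable_itv `]b, +oo[).
  rewrite (_ : _ `&` _ = dyD k `&` [set t | b < `|f t|])//.
  by apply/seteqP; split=> t /=; rewrite in_itv/= andbT.
(* [m k] is the essential supremum of [|f|] on the [k]th dyadic interval *)
have hm k : exists m : R, [/\ 0 <= m <= M,
    {ae mu, forall t, dyD k t -> `|f t| <= m} &
    0 < m -> (0 < mu (dyD k `&` [set t | (m / 2 < `|f t|)%R]))%E].
  pose u t : \bar R := (`| (f \_ (dyD k)) t |)%:E.
  pose e := ess_sup mu u.
  have e0 : (0 <= e)%E.
    by apply: ess_sup_gee; [exact: lebesgue_measure_setT_gt0|apply: aeW => t; rewrite lee_fin].
  have eM : (e <= M%:E)%E.
    apply/ess_supP; have := @ae_sub_dyD k _ hf; apply: filterS => t h.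
    rewrite /u lee_fin /patch; case: ifPn => [|_]; last by rewrite normr0.
    by rewrite inE => /h.
  have ef : e \is a fin_num by rewrite ge0_fin_numE// (le_lt_trans eM)// ltry.
  exists (fine e); split.
  - by rewrite fine_ge0// -lee_fin fineK.
  - have : (ess_sup mu u <= e)%E by [].
    move/ess_supP; apply: filterS => t h Dt; move: h.
    by rewrite -(fineK ef) lee_fin /patch mem_set.
  - move=> ep; rewrite lt_neqAle measure_ge0 andbT eq_sym; apply/negP => /eqP B0.
    have : (ess_sup mu u <= (fine e / 2)%:E)%E.
      apply/ess_supP; exists (dyD k `&` [set t | (fine e / 2 < `|f t|)%R]); split; [exact: mset|by []|].
      move=> t /=; rewrite /u lee_fin /patch; case: ifPn => [|_ h].
        by rewrite inE => Dt /negP; rewrite -ltNge.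
      by exfalso; apply: h; rewrite normr0 divr_ge0// fine_ge0.
    rewrite -/e -{1}(fineK ef) lee_fin; lra.
have [m hmm] := choice hm.
have m0 k : 0 <= m k by case: (hmm k) => /andP[].
(* If [m k > 0] this set has positive measure, and the average of [|f|] over it is at least
   [m k / 2]. *)
pose E k := dyD k `&` [set t | m k / 2 < `|f t|].
have mE k : measurable (E k) by exact: mset.
have [k0 mk0] : exists k0, 0 < m k0.
  apply: contrapT => nk; have mz k : m k = 0.
    apply/eqP; rewrite eq_le m0 andbT leNgt; apply/negP => h; apply: nk; by exists k.
  have : (G f <= 0%:E * G f)%E.
    apply: (lattice_leM hB) => //; apply: ae_dyD => k; have [_ h _] := hmm k.
    by apply: filterS h => t h Dt; rewrite mul0r -(mz k) h.
  by rewrite mul0e leNgt Gf0.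
(* A point of the [k]th interval may be as small as about [2^-(k+1)], where the factor
   [min(1, t / 2^-k)] is only at least [1/2]. *)
pose c k := 2 * m k.
have cM k : 0 <= c k <= 2 * M.
  by rewrite mulr_ge0//= ler_pM2l//; case: (hmm k) => /andP[].
pose phi := dyhull c.
have qphi : quasiconcave phi by apply: (quasiconcave_dyhull cM (k0 := k0)); rewrite mulr_gt0.
have d0 k : 0 < dy k :> R := dy_gt0 k.
exists phi; split => //; last first.
  apply: ae_dyD => k; have [_ h _] := hmm k; apply: filterS h => t h Dt.
  have /andP[t0 t1] := dyD_gt0 Dt.
  apply: (le_trans (h Dt)); apply: le_trans (dyhull_ge cM k (ltW t0)).
  have : 2^-1 <= Num.min 1 (t / dy k).
    rewrite le_min invf_le1// ler1n/= ler_pdivlMr// mulrC -dyS ltW//.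
    by move: Dt => /dyDE/andP[].
  rewrite -(ler_pM2l (ltr0n R 2)) mulfV// => h2.
  rewrite /c mulrA (mulrC _ 2) -[leLHS]mul1r ler_wpM2r//.
(* The supremum in the hull need not be attained; half of it always is, since [phi] is positive. *)
have hk j : exists k, phi (dy j) / 2 <= Num.min 1 (dy j / dy k) * c k.
  have pj : 0 < phi (dy j) by apply: (qc_gt0 qphi); rewrite d0 dy_le1.
  have [k /ltW hk] := dyhull_adherent cM (ltW (d0 j)) (divr_gt0 pj (ltr0n R 2)).
  by exists k; apply: le_trans hk; rewrite -/phi; lra.
have [kk hkk] := choice hk.
(* The coefficient of [c (kk j)] in the hull at [2^-j] is exactly a weight that [dyop] admits. *)
pose w j := Num.min 1 (dy j / dy (kk j)) : R.
have w01 j : 0 <= w j <= 1.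
  by rewrite /w le_min ler01 divr_ge0 ?(ltW (d0 _))//= ge_min lexx.
have wk j : w j * dy (kk j) <= dy j.
  by rewrite -ler_pdivlMr// /w ge_min lexx orbT.
have ED k : E k `<=` dyD k by move=> t [].
have [D D0 hD] := bounded_on_ge0 hB (dyop_bounded mE ED w01 wk).
pose af t := `|f t|.
have maf : measurable_fun (@I01 R) af by exact: measurableT_comp.
have Gaf : (G af <= G f)%E.
  by apply: (lattice_le hB) => //; apply: aeW => t _; rewrite normr_id.
have Gaf' := le_lt_trans Gaf Gf.
(* On the [j]th interval, with [k = kk j]: [phi(t) <= phi(2^-j) <= 2 w_j c_k = 4 w_j m_k], and [m_k]
   is at most twice the average, which gives 8. *)
apply: (@le_lt_trans _ _ (8%:E * G (dyop E w kk af))%E); last first.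
  rewrite lte_mul_pinfty//; apply: (le_lt_trans (hD _ Gaf')).
  by rewrite lte_mul_pinfty// ?lee_fin ?(lattice_ge0 hB).
apply: (lattice_leM_pointwise hB) => //; first exact: measurable_quasiconcave.
move=> t t01; have /andP[t0 t1] := t01.
rewrite gtr0_norm ?(qc_gt0 qphi)//.
have Dt := dyidxP t01; set j := dyidx t in Dt *.
have pj : phi t <= phi (dy j).
  by apply: (qc_nd qphi); rewrite ?(ltW t0) ?dy_le1//; move: Dt => /dyDE/andP[].
have pt : 0 < phi t by exact: (qc_gt0 qphi).
apply: (le_trans _ (_ : 8 * dyop E w kk af t <= _)); last first.
  by rewrite ler_pM2l// ler_norm.
rewrite /dyop -/j; have := hkk j; rewrite -/(w j) /c => hj.
have /andP[wj0 wj1] := w01 j.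
have mkp : 0 < m (kk j).
  rewrite lt_neqAle m0 andbT eq_sym; apply/eqP => mz.
  by move: hj; rewrite mz !mulr0; lra.
have : m (kk j) / 2 <= avg (E (kk j)) af.
  apply: (avg_ge _ _ M0) => //.
  - exact: mu_dyD_fin (@ED _).
  - by apply: measurable_funS maf; [exact: measurable_itv|exact: subset_trans (@ED _) (@dyD_I01 R _)].
  - apply: filterS hf => s h Es; rewrite normr_id; apply: h.
    by apply: dyD_I01; exact: ED Es.
  - by move=> s [_ /= /ltW].
  - by have [_ _] := hmm (kk j); apply.
move=> ha; have : w j * (m (kk j) / 2) <= w j * avg (E (kk j)) af by rewrite ler_wpM2l.
lra.
Qed.

End majorant.

(** * A uniform constant for the majorants *)

Section uniform_majorant.
Context {R : realType}.
Variable G : (R -> R) -> \bar R.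
Hypothesis hG : interpolation_lattice G.
Notation mu := (@lebesgue_measure R).
Let hB := interpolation_banach hG.
Implicit Types f g : R -> R.
Local Open Scope ereal_scope.

Lemma latticeN f : G (- f)%R = G f.
Proof. by rewrite -scaleN1r (lattice_scale hB) normrN1 mul1e. Qed.

Lemma lattice_abs f : G f < +oo -> G (fun t => `|f t|)%R = G f.
Proof.
move=> h; have mf := lattice_measurable hB h.
apply/eqP; rewrite eq_le; apply/andP; split; apply: (lattice_le hB) => //.
- by apply: measurableT_comp.
- by apply: aeW => t _; rewrite normr_id.
- by apply: aeW => t _; rewrite normr_id.
Qed.

(** The partial sums are Cauchy, their tails being bounded by those of a geometric series. As the
    terms are nonnegative, the norm limit dominates each of them almost everywhere. *)
Lemma lattice_series_sup (g : nat -> R -> R) : (forall n t, 0 <= g n t)%R ->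
  (forall n, G (g n) <= (2^-1 ^+ n)%:E) ->
  exists2 F, G F < +oo & forall n, {ae mu, forall t, @I01 R t -> (g n t <= F t)%R}.
Proof.
move=> g0 Gg; pose u n : R -> R := fun t => (\sum_(i < n) g i t)%R.
have uS n : u n.+1 = (u n + g n)%R by apply/funext => t; rewrite /u big_ord_recr.
have u0 : u 0%N = 0%R by apply/funext => t; rewrite /u big_ord0.
have gf n : G (g n) < +oo by apply: le_lt_trans (Gg n) _; rewrite ltry.
have G00 : G 0%R = 0 by rewrite -(scale0r (g 0%N)) (lattice_scale hB) normr0 mul0e.
have uf n : G (u n) < +oo.
  elim: n => [|n IH]; first by rewrite u0 G00.
  rewrite uS; apply: (le_lt_trans (lattice_triangle hB _ _)).
  by rewrite lte_add_pinfty.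
have ud n k : G (u (n + k)%N - u n)%R <= (2 * 2^-1 ^+ n - 2 * 2^-1 ^+ (n + k))%:E.
  elim: k => [|k IH]; first by rewrite addn0 !subrr G00.
  rewrite addnS uS addrAC; apply: (le_trans (lattice_triangle hB _ _)).
  apply: (le_trans (leeD IH (Gg _))); rewrite -EFinD lee_fin exprS.
  by rewrite mulrA mulfV// mul1r; lra.
have [F GF hF] : exists2 F, G F < +oo & G (u n - F)%R @[n --> \oo] --> 0.
  apply: (lattice_complete hB) => // e e0.
  have e2 : (0 < e / 4)%R by rewrite divr_gt0.
  have [n0 hn0] := half_expn_le e2.
  have half m n : (n0 <= n)%N -> (n <= m)%N -> G (u m - u n)%R < e%:E.
    move=> n0n nm; rewrite -(subnKC nm); apply: (le_lt_trans (ud _ _)); rewrite lte_fin.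
    have h1 : (2^-1 ^+ n <= 2^-1 ^+ n0 :> R)%R := dy_anti n0n.
    have h2 : (0 < 2^-1 ^+ (n + (m - n)) :> R)%R := dy_gt0 _.
    lra.
  exists n0 => m n hm hn; case: (leqP n m) => [nm|/ltnW mn]; first exact: half.
  by rewrite -latticeN opprB; exact: half.
exists F => // n.
(* The excess of [g n] over the limit is below [|u m - F|] for every [m > n], so its norm is 0. *)
pose p : R -> R := fun t => (Num.max 0 (g n t - F t))%R.
have mp : measurable_fun (@I01 R) p.
  apply: measurable_maxr => //; apply: measurable_funB; exact: (lattice_measurable hB).
have pu m : (n < m)%N -> G p <= G (u m - F)%R.
  move=> nm; apply: (lattice_le hB) => //; apply: aeW => t _.
  have gu : (g n t <= u m t)%R.
    rewrite /u (bigD1 (Ordinal nm))//= lerDl sumr_ge0// => i _; exact: g0.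
  rewrite ger0_norm; last by rewrite le_max lexx.
  rewrite ge_max normr_ge0/=; apply: le_trans (ler_norm _).
  by rewrite lerD2r.
have p0 : G p = 0.
  apply/eqP; rewrite eq_le (lattice_ge0 hB) andbT; apply/lee_addgt0Pr => e e0; rewrite add0e.
  have /= := hF; move/fine_cvgP => [[n1 _ fin1] ].
  move/cvgrPdist_le => /(_ e e0)[n2 _ hn2].
  pose m := maxn n.+1 (maxn n1 n2).
  have nm : (n < m)%N by rewrite /m leq_max leqnn.
  have n1m : (n1 <= m)%N by rewrite /m !leq_max leqnn orbT.
  have n2m : (n2 <= m)%N by rewrite /m !leq_max leqnn !orbT.
  apply: (le_trans (pu m nm)).
  have := hn2 m n2m; rewrite /= sub0r normrN => h.
  rewrite -(fineK (fin1 m n1m)) lee_fin.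
  by apply: le_trans h; exact: ler_norm.
apply: filterS (lattice_eq0 hB p0) => t h It; have := h It.
move=> hp; have : (g n t - F t <= p t)%R by rewrite le_max lexx orbT.
by rewrite hp subr_le0.
Qed.

Lemma interpolation_has_majorants : has_majorants G.
Proof.
apply: contrapT => nM.
have ex n : exists g, [/\ (forall t, 0 <= g t)%R, G g = (2^-1 ^+ n)%:E &
    forall phi, quasiconcave phi -> {ae mu, forall t, @I01 R t -> (g t <= phi t)%R} ->
      (2 ^+ n)%:E <= G phi].
  (* A function with no majorant within the factor [4^n], scaled to norm [2^-n]: the norms stay
     summable while every majorant has norm at least [4^n 2^-n = 2^n]. *)
  apply: contrapT => ng; apply: nM; exists (4 ^+ n)%R => [|f /andP[Gf0 Gf]].
    by rewrite exprn_ge0.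
  apply: contrapT => nphi; apply: ng.
  have Gff : G f \is a fin_num by rewrite ge0_fin_numE// (lattice_ge0 hB).
  have a0 : (0 < fine (G f))%R by rewrite fine_gt0// Gf0.
  pose a := (2^-1 ^+ n / fine (G f))%R.
  have ap : (0 < a)%R by rewrite divr_gt0// dy_gt0.
  exists (a *: (fun t => `|f t|))%R; split.
  - by move=> t; rewrite /GRing.scale/= mulr_ge0// ltW.
  - rewrite (lattice_scale hB) lattice_abs// (gtr0_norm ap) -(fineK Gff) -EFinM.
    by rewrite /a divfK// gt_eqF.
  - move=> phi qphi hphi; rewrite leNgt; apply/negP => Gphi; apply: nphi.
    have ai : (0 < a^-1)%R by rewrite invr_gt0.
    exists (a^-1 *: phi)%R; split.
    + split.
      * by rewrite /GRing.scale/= mulr_ge0 ?(ltW ai) ?(qc_ge0 qphi).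
      * by move=> t t01; rewrite /GRing.scale/= mulr_gt0 ?(qc_gt0 qphi).
      * by move=> s t s0 st t1; rewrite /GRing.scale/= ler_pM2l ?(qc_nd qphi).
      * move=> s t s0 st t1; rewrite /GRing.scale/= ![(_ * (a^-1 * _))%R]mulrCA.
        by rewrite ler_pM2l ?(qc_div qphi).
    + rewrite (lattice_scale hB) (gtr0_norm ai) lee_pdivrMl//.
      apply: (le_trans (ltW Gphi)); rewrite -(fineK Gff) -!EFinM lee_fin.
      rewrite /a mulrCA divfK ?gt_eqF// -exprMn (_ : 4 * 2^-1 = 2 :> R)%R//.
      by rewrite -[4%R]/(2 * 2)%:R natrM mulfK.
    + apply: filterS hphi => t h It; have := h It.
      by rewrite /GRing.scale/= ler_pdivlMl.
(* The sum of the [g n] has a single majorant, which is then a majorant of each. *)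
have [g hg] := choice ex.
have [F GF hF] : exists2 F, G F < +oo &
    forall n, {ae mu, forall t, @I01 R t -> (g n t <= F t)%R}.
  by apply: lattice_series_sup => [n t|n]; have [h1 h2 _] := hg n; [exact: h1|rewrite h2].
have GF0 : 0 < G F.
  have [h1 h2 _] := hg 0%N; apply: (@lt_le_trans _ _ (G (g 0%N))).
    by rewrite h2 expr0 lte_fin.
  apply: (lattice_le hB).
    by apply: (lattice_measurable hB); rewrite h2 ltry.
  apply: filterS (hF 0%N) => t h It; rewrite ger0_norm ?h1//.
  by apply: (le_trans (h It)); exact: ler_norm.
have [|phi [qphi Gphi hphi]] := @majorant_exists _ _ hG F; first by rewrite GF0.
have big n : (2 ^+ n)%:E <= G phi.
  have [_ _] := hg n; apply => //.
  apply: filterS2 (hF n) hphi => t h1 h2 It.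
  by rewrite (le_trans (h1 It))// (le_trans _ (h2 It))// ler_norm.
have Gpf : G phi \is a fin_num by rewrite ge0_fin_numE// (lattice_ge0 hB).
have := truncnS_gt (fine (G phi)); set N := (X in X.+1) => hN.
have := big N.+1; rewrite -(fineK Gpf) lee_fin leNgt => /negP; apply.
apply: (lt_trans hN); rewrite -natrX ltr_nat; exact: ltn_expl.
Qed.

End uniform_majorant.

(** * Realizing quasi-concave functions as K-functionals *)

Section L1_Linfty.
Context {R : realType}.
Implicit Types f g : R -> R.
Local Open Scope ereal_scope.
Notation mu := (@lebesgue_measure R).

Lemma Lp1E f : measurable_fun (@I01 R) f ->
  Lp 1 f = \int[mu]_(t in @I01 R) `|(f t)%:E|.
Proof.
move=> mf; rewrite /Lp asboolT// Lnorm1 [RHS]integral_mkcond.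
apply: eq_integral => t _; rewrite /= /patch; case: ifPn => //.
by rewrite normr0.
Qed.

Lemma Lp_notmeasurable p f : ~ measurable_fun (@I01 R) f -> Lp p f = +oo.
Proof. by move=> mf; rewrite /Lp asboolF. Qed.

Lemma LpN p f : Lp p (- f)%R = Lp p f.
Proof.
have mN g : measurable_fun (@I01 R) g -> measurable_fun (@I01 R) (- g)%R.
  by move=> mg; apply: measurableT_comp.
have [mf|nf] := pselect (measurable_fun (@I01 R) f); last first.
  by rewrite !Lp_notmeasurable// => /mN; rewrite opprK.
rewrite /Lp !asboolT//; last exact: mN.
rewrite -[RHS]oppe_Lnorm; apply: eq_Lnorm => t /=; rewrite /patch.
by case: ifP; rewrite // oppr0.
Qed.

Lemma Lp1_add f g : Lp 1 (f + g)%R <= Lp 1 f + Lp 1 g.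
Proof.
have [mf|nf] := pselect (measurable_fun (@I01 R) f); last first.
  rewrite (Lp_notmeasurable _ nf) addye ?leey// gt_eqF//.
  by rewrite (lt_le_trans _ (Lp_ge0 _ _)).
have [mg|ng] := pselect (measurable_fun (@I01 R) g); last first.
  rewrite (Lp_notmeasurable _ ng) addey ?leey// gt_eqF//.
  by rewrite (lt_le_trans _ (Lp_ge0 _ _)).
have mfg : measurable_fun (@I01 R) (f + g)%R by exact: measurable_funD.
rewrite !Lp1E// -ge0_integralD//; last 3 first.
- exact: measurable_itv.
- by apply/measurable_EFinP; exact: measurableT_comp.
- by apply/measurable_EFinP; exact: measurableT_comp.
apply: ge0_le_integral => //.
- exact: measurable_itv.
- by apply/measurable_EFinP; exact: measurableT_comp.
- by apply: emeasurable_funD; apply/measurable_EFinP; exact: measurableT_comp.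
- by move=> t _; rewrite -EFinD lee_fin ler_normD.
Qed.

Lemma mu_I01 : mu (@I01 R) = 1.
Proof. by rewrite lebesgue_measure_itv/= lte_fin ltr01 oppr0 adde0. Qed.

Lemma Lp1_le_Linfty f : Lp 1 f <= Lp +oo f.
Proof.
have [h|] := ltP (Lp +oo f) +oo; last by rewrite leye_eq => /eqP ->; rewrite leey.
have [M M0 fM] := Linfty_fin h.
have /(LinftyP _ M0)[mf hf] : Lp +oo f <= M%:E by rewrite fM.
rewrite fM Lp1E// -[leRHS]mule1 -mu_I01.
by apply: integral_ae_bound => //; exact: measurable_itv.
Qed.

Lemma ordered_L1_Linfty : ordered_norms (@Lp R 1) (@Lp R +oo).
Proof.
split.
- exact: Lp_ge0.
- exact: Lp1_add.
- exact: LpN.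
- apply/eqP; rewrite eq_le Lp_ge0 andbT; apply/LinftyP => //.
  by split; [exact: measurable_cst|apply: aeW => t _; rewrite normr0].
- exact: Lp1_le_Linfty.
Qed.

Section realization.
Variable psi : R -> R.
Hypotheses (qpsi : quasiconcave psi) (vpsi : vanishing psi).

Let d k : R := dy k.
Let d01 k : (0 < d k <= 1)%R. Proof. by rewrite dy_gt0 dy_le1. Qed.
Let d0 k : (0 < d k)%R. Proof. exact: dy_gt0. Qed.
Let a k := ((psi (d k) - psi (d k.+1)) / d k.+1)%R.
Let p0 k : (0 < psi (d k))%R. Proof. exact: (qc_gt0 qpsi). Qed.

Let psi_half k : (psi (d k) <= 2 * psi (d k.+1))%R.
Proof.
have : (d k.+1 * psi (d k) <= d k * psi (d k.+1))%R.
  by apply: (qc_div qpsi); rewrite ?d0 ?dy_anti ?dy_le1.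
have -> : d k = (2 * d k.+1)%R by rewrite /d dyS mulrCA mulfV// mulr1.
by rewrite mulrAC [leRHS]mulrC ler_pM2l.
Qed.

Let a_ge0 k : (0 <= a k)%R.
Proof.
rewrite divr_ge0 ?(ltW (d0 _))// subr_ge0; apply: (qc_nd qpsi); rewrite ?dy_le1 ?(ltW (d0 _))//.
by rewrite dy_anti.
Qed.

(** The slopes [a j] of a quasi-concave function need not be monotone. Doubling still gives
    [a j <= psi(d j.+1) / d j.+1], and this quotient grows with the index. *)
Let a_le j k : (j <= k)%N -> (a j <= psi (d k.+1) / d k.+1)%R.
Proof.
move=> jk; apply: (@le_trans _ _ (psi (d j.+1) / d j.+1)%R).
  rewrite ler_pM2r ?invr_gt0//; have := psi_half j; lra.
have h : (d k.+1 * psi (d j.+1) <= d j.+1 * psi (d k.+1))%R.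
  by apply: (qc_div qpsi); rewrite ?d0 ?dy_anti ?dy_le1.
by rewrite ler_pdivrMr// mulrAC ler_pdivlMr// mulrC [leRHS]mulrC.
Qed.

(* Chosen so that the integrals over dyadic intervals are the increments of [psi]. *)
Definition profile (t : R) : R := if (0 < t <= 1)%R then a (dyidx t) else 0%R.

Let x_ge0 t : (0 <= profile t)%R.
Proof. by rewrite /profile; case: ifP. Qed.

Let xE k t : dyD k t -> profile t = a k.
Proof. by move=> Dt; rewrite /profile (dyD_gt0 Dt) (dyidxE Dt). Qed.

Let mx : measurable_fun (@I01 R) profile.
Proof.
apply: measurable_I01_dyD => k; apply: (eq_measurable_fun (cst (a k))).
  by move=> t; rewrite inE => /xE ->.
exact: measurable_cst.
Qed.

Let B k : set R := `]0%R, d k]%classic.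

Let mB k : measurable (B k). Proof. exact: measurable_itv. Qed.

Let BI01 k : B k `<=` @I01 R.
Proof.
move=> t; rewrite /B/= in_itv/= => /andP[t0 td]; apply/I01E.
by rewrite (ltW t0) (le_trans td)// dy_le1.
Qed.

Let mxB k : measurable_fun (B k) profile.
Proof. by apply: measurable_funS mx; [exact: measurable_itv|exact: BI01]. Qed.

Let B_bigcup k : B k = \bigcup_j dyD (k + j)%N.
Proof.
apply/seteqP; split=> [t|t [j _] /dyDE/andP[t0 t1]].
  rewrite /B/= in_itv/= => /andP[t0 td].
  have t01 : (0 < t <= 1)%R by rewrite t0 (le_trans td)// dy_le1.
  have Dt := dyidxP t01; exists (dyidx t - k)%N => //.
  rewrite subnKC// leqNgt; apply/negP => /dy_anti h.
  move: Dt => /dyDE/andP[].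
  by rewrite ltNge (le_trans td (h R)).
rewrite /B/= in_itv/= (lt_trans (dy_gt0 _) t0) (le_trans t1)//.
by rewrite dy_anti// leq_addr.
Qed.

Lemma mu_dyD k : mu (@dyD R k) = (dy k.+1)%:E.
Proof.
rewrite lebesgue_measure_itv/= lte_fin.
have -> : (dy k.+1 < dy k :> R)%R by rewrite dyS ltr_pdivrMr// ltr_pMr ?ltr1n// dy_gt0.
by rewrite -EFinD dyS; congr EFin; lra.
Qed.

(** The increments of [psi] over the dyadic intervals below [2^-k] telescope; the remaining term
    tends to 0 because [psi] vanishes at 0. *)
Lemma integral_profile k : \int[mu]_(t in B k) (profile t)%:E = (psi (d k))%:E.
Proof.
have tI : trivIset setT (fun j => @dyD R (k + j)%N).
  apply/trivIsetP => i j _ _ /eqP ij; apply/seteqP; split=> // t [h1 h2]; exfalso.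
  by apply: ij; have /eqP := dyD_inj h1 h2; rewrite eqn_add2l => /eqP.
have mD j : measurable (@dyD R (k + j)%N) by exact: measurable_dyD.
rewrite B_bigcup ge0_integral_bigcup//; last 2 first.
- by rewrite -B_bigcup; apply/measurable_EFinP; exact: mxB.
- by move=> t _; rewrite lee_fin.
have E j : \int[mu]_(t in dyD (k + j)%N) (profile t)%:E =
    (psi (d (k + j)%N) - psi (d (k + j.+1)%N))%:E.
  transitivity (\int[mu]_(t in dyD (k + j)%N) (a (k + j)%N)%:E).
    by apply: eq_integral => t; rewrite inE => /xE ->.
  transitivity ((a (k + j)%N)%:E * mu (@dyD R (k + j)%N)).
    apply: integral_cst; exact: measurable_dyD.
  by rewrite mu_dyD -EFinM /a /d addnS divfK// gt_eqF// dy_gt0.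
apply/cvg_lim => //.
have -> : (fun n => \sum_(0 <= i < n) \int[mu]_(t in dyD (k + i)%N) (profile t)%:E) =
    (fun n => (psi (d k) - psi (d (k + n)%N))%:E).
  apply/funext => n; under eq_bigr do rewrite E.
  rewrite sumEFin; congr EFin; rewrite (@telescope_sumr_eq _ 0%N n (fun i => - psi (d (k + i)%N))%R)//.
    by rewrite addn0 opprK addrC.
  by move=> i _; rewrite opprK addrC.
apply: cvg_EFin; first exact: nearW.
rewrite -[X in _ --> X]subr0; apply: cvgB; first exact: cvg_cst.
apply/cvgrPdist_le => e e0; have [s /andP[s0 s1] hs] := vpsi e0.
have [n0 hn0] := half_expn_le s0.
exists n0 => // n /= n0n; rewrite sub0r normrN gtr0_norm//.
apply: le_trans (ltW hs); apply: (qc_nd qpsi) => //; first exact: ltW.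
by apply: le_trans hn0; rewrite dy_anti// (leq_trans n0n)// leq_addl.
Qed.

(** With [s] in the [k]th interval, both bounds work at [d k.+1], where [psi] is within a factor 2
    of [psi s]. From below, any decomposition is integrated over []0, d k.+1]], of length less than
    [s]. From above, the profile is cut at [d k.+1]: the [L^1] part has norm [psi(d k.+1)], and [s]
    times the bounded part at most twice that, so [3 = 1 + 2]. *)
Lemma realizing_profile : Lp 1 profile < +oo /\ forall s, (0 < s <= 1)%R ->
  (psi s)%:E <= 3%:E * Kfun (Lp 1) (Lp +oo) s profile /\
  Kfun (Lp 1) (Lp +oo) s profile <= (3 * psi s)%:E.
Proof.
have L1B (y : R -> R) k : measurable_fun (@I01 R) y ->
    (forall t, @I01 R t -> y t = if (t <= d k)%R then profile t else 0%R) ->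
    Lp 1 y = (psi (d k))%:E.
  move=> my yE; rewrite Lp1E// -integral_profile.
  rewrite integral_mkcond [RHS]integral_mkcond; apply: eq_integral => t _.
  rewrite /patch; case: ifPn => [|tI].
    rewrite inE => It; rewrite yE//; case: ifPn => td.
      have /I01E/andP[t0 t1] := It.
      case: ifPn => [_|]; first by rewrite /= ger0_norm.
      rewrite notin_setE /B/= in_itv/= td andbT => /negP; rewrite -leNgt => t0'.
      by rewrite /profile ltNge t0'/= normr0.
    rewrite /= normr0; case: ifPn => //; rewrite inE /B/= in_itv/= => /andP[_ td'].
    by rewrite td' in td.
  case: ifPn => //; rewrite inE => /BI01; move: tI; rewrite notin_setE => n It.
  by exfalso.
have L1x : Lp 1 profile = (psi (d 0%N))%:E.
  apply: L1B => // t /I01E/andP[_ t1].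
  by rewrite /d /dy expr0 t1.
split; first by rewrite L1x ltry.
move=> s s01; have /andP[s0 s1] := s01.
have Ds := dyidxP s01; set k := dyidx s in Ds *.
have /dyDE/andP[ds sd] := Ds.
have hp : (psi (d k.+1) <= psi s)%R by apply: (qc_nd qpsi) => //; [exact: ltW|exact: ltW].
have hp2 : (psi s <= 2 * psi (d k.+1))%R.
  by apply: le_trans (psi_half k); apply: (qc_nd qpsi) => //; [exact: ltW|exact: dy_le1].
split.
  apply: Kfun_geZ => // y0 y1 xy h0 h1.
  have m0 := Lp_measurable h0; have m1 := Lp_measurable h1.
  have [M M0 yM] := Linfty_fin h1.
  have /(LinftyP _ M0)[_ hM] : Lp +oo y1 <= M%:E by rewrite yM.
  have mBy (y : R -> R) : measurable_fun (@I01 R) y -> measurable_fun (B k.+1) y.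
    by apply: measurable_funS; [exact: measurable_itv|exact: BI01].
  have mBn (y : R -> R) : measurable_fun (@I01 R) y -> measurable_fun (B k.+1) (fun t => `|(y t)%:E|).
    by move=> my; apply/measurable_EFinP; apply: measurableT_comp => //; exact: mBy.
  have muB : mu (B k.+1) = (d k.+1)%:E.
    by rewrite lebesgue_measure_itv/= lte_fin d0 oppr0 adde0.
  have I1 : \int[mu]_(t in B k.+1) `|(y1 t)%:E| <= (M * d k.+1)%:E.
    rewrite EFinM -muB; apply: integral_ae_bound => //; first exact: mBy.
    by apply: filterS hM => t h Bt; apply: h; exact: BI01 Bt.
  have I0 : \int[mu]_(t in B k.+1) `|(y0 t)%:E| <= Lp 1 y0.
    rewrite Lp1E//; apply: ge0_subset_integral => //.
    - exact: measurable_itv.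
    - exact: measurable_itv.
    - by apply: measurableT_comp => //; exact/measurable_EFinP.
  have I : (psi (d k.+1))%:E <= Lp 1 y0 + s%:E * Lp +oo y1.
    rewrite -integral_profile.
    apply: (@le_trans _ _ (\int[mu]_(t in B k.+1) (`|(y0 t)%:E| + `|(y1 t)%:E|))).
      apply: ge0_le_integral => //.
      - exact: measurable_itv.
      - by move=> t _; rewrite lee_fin.
      - by apply/measurable_EFinP; exact: mxB.
      - by apply: emeasurable_funD; exact: mBn.
      - move=> t _; rewrite -EFinD lee_fin xy; apply: le_trans (ler_normD _ _).
        exact: ler_norm.
    rewrite ge0_integralD//; [|exact: measurable_itv|exact: mBn|exact: mBn].
    apply: leeD => //; apply: (le_trans I1); rewrite yM -EFinM lee_fin mulrC.
    by rewrite ler_wpM2r// ltW.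
  apply: (@le_trans _ _ (3 * psi (d k.+1))%:E).
    by rewrite lee_fin; have := p0 k.+1; lra.
  by rewrite EFinM lee_wpmul2l.
pose x0 (t : R) := if (t <= d k.+1)%R then profile t else 0%R.
pose x1 (t : R) := if (t <= d k.+1)%R then 0%R else profile t.
have mx0 : measurable_fun (@I01 R) x0.
  apply: measurable_I01_dyD => j.
  apply: (eq_measurable_fun (cst (if (j <= k)%N then 0 else a j)%R)); last exact: measurable_cst.
  move=> t; rewrite inE => Dt; rewrite /x0 /= (xE Dt); move: Dt => /dyDE/andP[jt tj].
  case: (leqP j k) => [jk|kj].
    by rewrite leNgt (le_lt_trans _ jt)// dy_anti.
  by rewrite (le_trans tj)// dy_anti.
have mx1 : measurable_fun (@I01 R) x1.
  rewrite (_ : x1 = profile - x0)%R; first exact: measurable_funB.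
  apply/funext => t; rewrite /x1 /x0 !fctE/=.
  by case: ifP => _; rewrite ?subrr ?subr0.
have x01 : profile = (x0 + x1)%R.
  apply/funext => t; rewrite /x1 /x0 !fctE/=.
  by case: ifP => _; rewrite ?addr0 ?add0r.
have Lx0 : Lp 1 x0 = (psi (d k.+1))%:E by exact: L1B.
have Lx1 : Lp +oo x1 <= (psi (d k.+1) / d k.+1)%:E.
  apply/LinftyP; first by rewrite divr_ge0// ltW.
  split => //; apply: aeW => t It; rewrite /x1; case: ifPn => [_|].
    by rewrite normr0 divr_ge0// ltW.
  rewrite -ltNge => dt; rewrite ger0_norm//.
  have t01 : (0 < t <= 1)%R by move: It => /I01E/andP[_ ->]; rewrite (lt_trans (d0 _) dt).
  rewrite /profile t01; apply: a_le; have := dyidxP t01 => /dyDE/andP[_ td].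
  rewrite leqNgt; apply/negP => /dy_anti h.
  by have := lt_le_trans dt (le_trans td (h R)); rewrite ltxx.
apply: (le_trans (Kfun_le_dec s x01 _ _)).
- by rewrite Lx0 ltry.
- by rewrite (le_lt_trans Lx1)// ltry.
apply: (@le_trans _ _ ((psi (d k.+1))%:E + s%:E * (psi (d k.+1) / d k.+1)%:E)).
  by rewrite Lx0 leeD2l// lee_wpmul2l// lee_fin ltW.
rewrite -EFinM -EFinD lee_fin.
have : (s * (psi (d k.+1) / d k.+1) <= 2 * psi (d k.+1))%R.
  rewrite mulrCA mulrC ler_wpM2r ?(ltW (p0 _))// ler_pdivrMr//.
  by rewrite (le_trans sd)// /d dyS mulrCA mulfV// mulr1.
lra.
Qed.

End realization.

Lemma realizing_L1_Linfty : realizing (@Lp R 1) (@Lp R +oo).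
Proof.
exists 3%R => // psi q v; exists (profile psi);
  by have [] := realizing_profile q v.
Qed.

End L1_Linfty.

(** * A Banach pair of weighted spaces of bounded functions *)

Section bounded_functions.
Variable R : realType.

Definition bounded_pred : {pred R -> R} :=
  fun f => `[< exists M : R, forall t, `|f t| <= M >].

Lemma bounded_submod_closed : submod_closed bounded_pred.
Proof.
split=> [|a f g /asboolP[M hM] /asboolP[N hN]]; apply/asboolP.
  by exists 0 => t; rewrite normr0.
exists (`|a| * M + N) => t; apply: (le_trans (ler_normD _ _)).
by rewrite lerD// normrM ler_wpM2l.
Qed.

HB.instance Definition _ :=
  GRing.isSubmodClosed.Build R (R -> R) bounded_pred bounded_submod_closed.

(** Everywhere bounded functions rather than classes: equality is pointwise and the supremum is a
    norm without a quotient. *)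
Record bfun := BFun { bfun_fun :> R -> R; bfun_bounded : bfun_fun \in bounded_pred }.

HB.instance Definition _ := [isSub for bfun_fun].
HB.instance Definition _ := [Choice of bfun by <:].
HB.instance Definition _ := [SubChoice_isSubLmodule of bfun by <:].

Definition bfun_norm (f : bfun) : R := sup (range (fun t => `|f t|)).

Lemma bfun_has_sup (f : bfun) : has_sup (range (fun t => `|f t|)).
Proof.
split; first by exists `|f 0|, 0.
have /asboolP[M hM] := bfun_bounded f.
by exists M => _ [t _ <-].
Qed.

Lemma bfun_norm_ge (f : bfun) t : `|f t| <= bfun_norm f.
Proof. by apply: ub_le_sup; [case: (bfun_has_sup f)|exists t]. Qed.

Lemma bfun_norm_le (f : bfun) (M : R) : (forall t, `|f t| <= M) -> bfun_norm f <= M.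
Proof.
move=> h; apply: ge_sup; first by case: (bfun_has_sup f).
by move=> _ [t _ <-].
Qed.

Lemma bfunD (f g : bfun) t : (f + g) t = f t + g t.
Proof. by []. Qed.

Lemma bfunZ (a : R) (f : bfun) t : (a *: f) t = a * f t.
Proof. by []. Qed.

Lemma bfun_eq (f g : bfun) : (forall t, f t = g t) -> f = g.
Proof. by move=> h; apply: val_inj; apply/funext. Qed.

Lemma bfun_normD (f g : bfun) : bfun_norm (f + g) <= bfun_norm f + bfun_norm g.
Proof.
apply: bfun_norm_le => t; rewrite bfunD.
by apply: (le_trans (ler_normD _ _)); rewrite lerD ?bfun_norm_ge.
Qed.

Lemma bfun_normZ (a : R) (f : bfun) : bfun_norm (a *: f) = `|a| * bfun_norm f.
Proof.
have le (b : R) (g : bfun) : bfun_norm (b *: g) <= `|b| * bfun_norm g.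
  by apply: bfun_norm_le => t; rewrite bfunZ normrM ler_wpM2l// bfun_norm_ge.
apply/eqP; rewrite eq_le le/=; have [->|a0] := eqVneq a 0.
  by rewrite normr0 mul0r (le_trans (normr_ge0 ((0 *: f : bfun) 0)))// bfun_norm_ge.
have na : 0 < `|a| by rewrite normr_gt0.
rewrite -ler_pdivlMl//.
have {1}-> : f = a^-1 *: (a *: f) by rewrite scalerA mulVf// scale1r.
by rewrite -normfV; exact: le.
Qed.

Lemma bfun_norm_eq0 (f : bfun) : bfun_norm f = 0 -> f = 0.
Proof.
move=> h; apply: bfun_eq => t; apply/eqP; rewrite -normr_le0 -h.
exact: bfun_norm_ge.
Qed.

HB.instance Definition _ :=
  Lmodule_isNormed.Build R bfun bfun_normD bfun_normZ bfun_norm_eq0.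

(** The limit is taken pointwise in the complete line; [lE] shows that the approximation is uniform
    in [t]. *)
Lemma bfun_complete (F : set_system bfun) : ProperFilter F -> cauchy F -> cvg F.
Proof.
move=> FF /cauchyP Fc.
pose ev t (f : bfun) : R := f t.
have evd t (f g : bfun) (e : R) : ball f e g -> `|f t - g t| < e.
  rewrite -ball_normE/= => h; apply: le_lt_trans h.
  exact: (bfun_norm_ge (f - g) t).
have evc t : cvg (ev t @ F).
  apply: cauchy_cvg; apply: cauchy_exP => e e0; have [f hf] := Fc e e0.
  exists (f t); suff : F (ev t @^-1` ball (f t) e) by [].
  by apply: filterS hf => g /(evd t).
pose l t : R := lim (ev t @ F).
have lE (e : R) (f : bfun) : 0 < e -> F (ball f e) -> forall t, `|f t - l t| <= e.
  move=> e0 hf t; rewrite distrC.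
  have h := evc t; apply/ler_addgt0Pr => d d0.
  have [g hg] : exists g : bfun, ball f e g /\ `|l t - g t| < d.
    have h2 : F [set g : bfun | `|l t - g t| < d].
      by move/cvgrPdist_lt : h => /(_ d d0).
    by have [g [h3 h4]] := filter_ex (filterI hf h2); exists g.
  case: hg => /(evd t) h3 h4.
  rewrite (le_trans (ler_distD (g t) _ _))// addrC; apply: lerD; last exact: ltW.
  by rewrite distrC ltW.
have lb : l \in bounded_pred.
  have [f hf] := Fc 1 ltr01; have h := lE 1 f ltr01 hf.
  apply/asboolP; exists (1 + bfun_norm f) => t.
  rewrite -(subrK (f t) (l t)) (le_trans (ler_normD _ _))// lerD ?bfun_norm_ge//.
  by rewrite distrC.
apply/cvg_ex; exists (BFun lb); apply/cvgrPdist_le => e e0.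
have e2 : 0 < e / 2 by rewrite divr_gt0.
have [f hf] := Fc _ e2; have h := lE _ f e2 hf.
apply: filterS hf => g /evd hg; apply: bfun_norm_le => t.
change (`|l t - g t| <= e); rewrite (le_trans (ler_distD (f t) _ _))// (splitr e).
by apply: lerD; [rewrite distrC|exact: ltW].
Qed.

HB.instance Definition _ := Uniform_isComplete.Build bfun bfun_complete.

End bounded_functions.

Section bounded_pair.
Variable R : realType.
Local Notation X := (bfun R).

(** The value 1 off []0, 1]] keeps the weight positive and at most 1 on the whole line, so that
    multiplication by it is injective and contractive. *)
Definition weight (t : R) : R := if (0 < t <= 1) then t else 1.

Lemma weight_gt0 t : 0 < weight t.
Proof. by rewrite /weight; case: ifP => // /andP[]. Qed.

Lemma weight_le1 t : weight t <= 1.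
Proof. by rewrite /weight; case: ifP => // /andP[]. Qed.

Lemma weightM_bounded (f : X) : (fun t => weight t * f t) \in @bounded_pred R.
Proof.
apply/asboolP; exists (bfun_norm f) => t.
rewrite normrM (gtr0_norm (weight_gt0 t)).
apply: le_trans (bfun_norm_ge f t).
by rewrite ler_piMl// weight_le1.
Qed.

Definition weightM (f : X) : X := BFun (weightM_bounded f).

Lemma weightM_linear : linear weightM.
Proof.
by move=> a f g; apply: bfun_eq => t; rewrite /= mulrDr mulrCA.
Qed.

HB.instance Definition _ := GRing.isLinear.Build R X X *:%R weightM weightM_linear.

Lemma weightM_inj : injective weightM.
Proof.
move=> f g fg; apply: bfun_eq => t.
have : weight t * f t = weight t * g t by exact: (congr1 (fun h : X => h t) fg).
by apply: mulfI; rewrite gt_eqF// weight_gt0.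
Qed.

Lemma weightM_norm (f : X) : `|weightM f| <= `|f|.
Proof.
apply: bfun_norm_le => t; rewrite /= normrM (gtr0_norm (weight_gt0 t)).
apply: le_trans (bfun_norm_ge f t).
by rewrite ler_piMl// weight_le1.
Qed.

Lemma weightM_continuous : continuous weightM.
Proof.
move=> f; have FF : Filter (nbhs (f : X)) by exact: nbhs_filter.
suff : weightM @ (nbhs (f : X)) --> weightM f by [].
apply/cvgrPdist_lt => e e0.
have : nbhs f (ball f e) by exact: nbhsx_ballx.
apply: filterS => g; rewrite -ball_normE /= -linearB => h.
exact: le_lt_trans (weightM_norm _) h.
Qed.

(** The second space is [{v : v / weight is bounded}]: an element is stored as the quotient
    [v / weight] and embedded by multiplication. The first space is its own ambient space. *)
Definition bounded_pair : banach_pair R :=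
  @BanachPair R X X X idfun weightM (@norm_hausdorff _ X) (fun x y h => h)
    weightM_inj (fun x => cvg_id) weightM_continuous.
End bounded_pair.

Section banach_pair_norms.
Context {R : realType}.
Variable A : banach_pair R.
Local Open Scope ereal_scope.

Lemma norm0_emb a : norm0 (emb0 A a) = (`|a|)%:E.
Proof.
apply/eqP; rewrite eq_le; apply/andP; split.
  by apply: ereal_inf_lbound; exists a.
by apply: le_ereal_inf_tmp => _ [b /= /(@emb0_inj _ A) -> <-].
Qed.

Lemma norm1_emb a : norm1 (emb1 A a) = (`|a|)%:E.
Proof.
apply/eqP; rewrite eq_le; apply/andP; split.
  by apply: ereal_inf_lbound; exists a.
by apply: le_ereal_inf_tmp => _ [b /= /(@emb1_inj _ A) -> <-].
Qed.

Lemma norm0_lty v : @norm0 _ A v < +oo -> exists a, v = emb0 A a.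
Proof. by move=> /ereal_inf_lt[_ [a /= <- _] _]; exists a. Qed.

Lemma norm1_lty v : @norm1 _ A v < +oo -> exists a, v = emb1 A a.
Proof. by move=> /ereal_inf_lt[_ [a /= <- _] _]; exists a. Qed.

Lemma norm0_ge0 v : 0 <= @norm0 _ A v.
Proof. by apply: le_ereal_inf_tmp => _ [b /= _ <-]; rewrite lee_fin. Qed.

Lemma ordered_banach_pair : ordered A -> ordered_norms (@norm0 _ A) (@norm1 _ A).
Proof.
move=> oA.
have oppN v : norm0 (- v)%R <= @norm0 _ A v.
  have [/norm0_lty[a ->]|] := ltP (@norm0 _ A v) +oo; last first.
    by rewrite leye_eq => /eqP ->; rewrite leey.
  by rewrite -raddfN !norm0_emb normrN.
split.
- exact: norm0_ge0.
- move=> x y; have [/norm0_lty[a ->]|] := ltP (norm0 x) +oo; last first.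
    rewrite leye_eq => /eqP ->; rewrite addye ?leey// gt_eqF//.
    by rewrite (lt_le_trans _ (norm0_ge0 _)).
  have [/norm0_lty[b ->]|] := ltP (norm0 y) +oo; last first.
    rewrite leye_eq => /eqP ->; rewrite addey ?leey// gt_eqF//.
    by rewrite (lt_le_trans _ (norm0_ge0 _)).
  by rewrite -raddfD !norm0_emb -EFinD lee_fin ler_normD.
- move=> x; apply/eqP; rewrite eq_le oppN/=.
  by have := oppN (- x)%R; rewrite opprK.
- by rewrite -(raddf0 (emb1 A)) norm1_emb normr0.
- move=> x; have [/norm1_lty[a1 ->]|] := ltP (norm1 x) +oo; last first.
    by rewrite leye_eq => /eqP ->; rewrite leey.
  have [a0 e h] := oA a1.
  by rewrite -{1}e norm0_emb norm1_emb lee_fin.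
Qed.

End banach_pair_norms.

Section bounded_pair_norms.
Context {R : realType}.
Notation P := (bounded_pair R).

Lemma ordered_bounded_pair : ordered P.
Proof. by move=> f; exists (weightM f) => //; exact: weightM_norm. Qed.

(** The element is [psi] itself. Evaluating a decomposition at the point [s] bounds [psi(s)] by
    [|y0| + s |f|]. Cutting at [s] gives the converse: [psi <= psi(s)] on the left and
    [psi(t) / t <= psi(s) / s] on the right, in all [2 psi(s)]. *)
Lemma realizing_bounded_pair : realizing (@norm0 _ P) (@norm1 _ P).
Proof.
exists 2 => // psi qpsi _.
have p0 t : 0 < t <= 1 -> 0 < psi t by exact: (qc_gt0 qpsi).
have piece (c : R -> bool) (u : R -> R) (M : R) : 0 <= M ->
    (forall t, 0 < t <= 1 -> c t -> `|u t| <= M) ->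
    exists2 f : bfun R, (forall t, f t = if (0 < t <= 1) && c t then u t else 0) &
      `|f| <= M.
  move=> M0 h; pose v t := if (0 < t <= 1) && c t then u t else 0.
  have hv t : `|v t| <= M.
    by rewrite /v; case: ifPn => [/andP[t01 ct]|_]; [exact: h|rewrite normr0].
  have bv : v \in @bounded_pred R by apply/asboolP; exists M.
  by exists (BFun bv) => //; exact: bfun_norm_le.
have p1 : 0 <= psi 1 by rewrite ltW// p0// ltr01 lexx.
have [|x xE _] := @piece (fun=> true) psi (psi 1) p1.
  move=> t /[dup] t01 /andP[t0 t1] _; rewrite gtr0_norm ?p0//.
  by apply: (qc_nd qpsi) => //; exact: ltW.
have n0 (f : bfun R) : @norm0 _ P f = (`|f|)%:E by exact: (@norm0_emb _ P f).
exists x; first by rewrite n0 ltry.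
move=> s /[dup] s01 /andP[s0 s1]; split.
  apply: Kfun_geZ => // y0 y1 xy h0 h1.
  have [f yf] := norm1_lty h1; rewrite yf norm1_emb n0 -EFinM lee_fin.
  have : psi s = y0 s + s * f s.
    have := congr1 (fun g : bfun R => g s) xy; rewrite /= xE s01/= => ->.
    by rewrite yf; change (y0 s + weight s * f s = y0 s + s * f s); rewrite /weight s01.
  move=> ->; apply: (@le_trans _ _ (`|y0| + s * `|f|)); last first.
    by rewrite mulr_natl mulr2n lerDl addr_ge0// mulr_ge0// ltW.
  apply: lerD.
    by apply: le_trans (bfun_norm_ge y0 s); exact: ler_norm.
  by rewrite ler_pM2l//; apply: le_trans (bfun_norm_ge f s); exact: ler_norm.
have ps := p0 s s01.
have [|x0 x0E nx0] := @piece (fun t => t <= s) psi (psi s) (ltW ps).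
  move=> t /[dup] t01 /andP[t0 t1] ts; rewrite gtr0_norm ?p0//.
  by apply: (qc_nd qpsi) => //; exact: ltW.
have [|f fE nf] := @piece (fun t => s < t) (fun t => psi t / t) (psi s / s)
  (divr_ge0 (ltW ps) (ltW s0)).
  move=> t /[dup] t01 /andP[t0 t1] st; rewrite gtr0_norm ?divr_gt0 ?p0//.
  rewrite ler_pdivrMr// mulrAC ler_pdivlMr// mulrC [leRHS]mulrC.
  by apply: (qc_div qpsi) => //; exact: ltW.
have xD : x = (x0 : bfun R) + weightM f :> bfun R.
  apply: bfun_eq => t; rewrite bfunD /= xE x0E fE /weight andbT.
  case: ifPn => [t01|_]; last by rewrite mulr0 addr0.
  case: (leP t s) => _ /=; first by rewrite mulr0 addr0.
  have /andP[t0 _] := t01.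
  by rewrite add0r mulrCA mulfV ?mulr1// gt_eqF.
apply: (le_trans (@Kfun_le_dec _ _ _ _ s x x0 (weightM f) xD _ _)).
- by rewrite n0 ltry.
- by rewrite (@norm1_emb _ P f) ltry.
rewrite n0 (@norm1_emb _ P f) -EFinM -EFinD lee_fin mulr_natl mulr2n lerD//.
apply: (@le_trans _ _ (s * (psi s / s))); first by rewrite ler_pM2l.
by rewrite mulrCA mulfV ?mulr1// gt_eqF.
Qed.

End bounded_pair_norms.

(** * The equivalences *)

Lemma same_Kspace_sqrt_bounded {R : realType} (G : (R -> R) -> \bar R)
    (V : lmodType R) (N0 N1 : V -> \bar R) (theta1 theta2 : R) (q1 q2 : \bar R) :
  interpolation_lattice G -> ordered_norms N0 N1 -> realizing N0 N1 ->
  0 < theta1 < 1 -> 0 < theta2 < 1 -> theta1 != theta2 ->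
  (1 <= q1)%E -> (1 <= q2)%E ->
  same_space (Kspace G N0 (real_interp N0 N1 theta1 q1))
    (Kspace G N0 (real_interp N0 N1 theta2 q2)) ->
  bounded_on G (fun f t => f (Num.sqrt t)).
Proof.
move=> hG hN hR; have hB := interpolation_banach hG.
(* Equality of spaces is symmetric, and [Kspace_dilation] needs only the bound of the [theta2] norm
   by the [theta1] norm, for [theta1 < theta2]. *)
wlog th12 : theta1 theta2 q1 q2 / theta1 < theta2.
  move=> w h1 h2 ne hq1 hq2 ss; have ne' : theta2 != theta1 by rewrite eq_sym.
  have [lt|lt|eq] := ltgtP theta1 theta2.
  - exact: (w _ _ _ _ lt h1 h2 ne hq1 hq2 ss).
  - exact: (w _ _ _ _ lt h2 h1 ne' hq2 hq1 (same_space_sym ss)).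
  - by move: ne; rewrite eq eqxx.
move=> /andP[th10 _] /andP[_ th21] _ hq1 hq2 /same_space_sym/same_space_leP[c c0 hc].
have [d [C [d01 C0 hC]]] := Kspace_dilation hB hN hR th10 th12 th21 hq1 hq2 c0 hc.
have [D D0 hD] := dilation_iter hB d01 C0 hC.
exact: (sqrt_bounded_majorant hB (interpolation_emb hG) (interpolation_has_majorants hG) D0 hD).
Qed.

Theorem theorem6 (R : realType) (G : (R -> R) -> \bar R)
    (hG : interpolation_lattice G) :
  [<->
    (* (a) *)
    bounded_on G (fun f t => f (Num.sqrt t));
    (* (b) *)
    forall A : banach_pair R, ordered A ->
      forall (theta : R) (q : \bar R), 0 < theta < 1 -> (1 <= q)%E ->
        same_space (Kspace G (@norm0 R A) (@norm1 R A))
          (Kspace G (@norm0 R A)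
             (real_interp (@norm0 R A) (@norm1 R A) theta q));
    (* (c) *)
    forall A : banach_pair R, ordered A ->
      exists (theta1 theta2 : R) (q1 q2 : \bar R),
        [/\ 0 < theta1 < 1, 0 < theta2 < 1, theta1 != theta2,
            (1 <= q1)%E & (1 <= q2)%E] /\
        same_space
          (Kspace G (@norm0 R A)
             (real_interp (@norm0 R A) (@norm1 R A) theta1 q1))
          (Kspace G (@norm0 R A)
             (real_interp (@norm0 R A) (@norm1 R A) theta2 q2));
    (* (d) *)
    exists (theta1 theta2 : R) (q1 q2 : \bar R),
      [/\ 0 < theta1 < 1, 0 < theta2 < 1, theta1 != theta2,
          (1 <= q1)%E & (1 <= q2)%E] /\
      same_space
        (Kspace G (@Lp R 1%E)
           (real_interp (@Lp R 1%E) (@Lp R +oo%E) theta1 q1))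
        (Kspace G (@Lp R 1%E)
           (real_interp (@Lp R 1%E) (@Lp R +oo%E) theta2 q2))].
Proof.
have hB := interpolation_banach hG.
(* Stated for [ordered_norms] so that it applies to [Lp 1] and [Lp +oo], which live on functions and
   are not given as a [banach_pair]. *)
have ab : bounded_on G (fun f t => f (Num.sqrt t)) ->
    forall (V : lmodType R) (N0 N1 : V -> \bar R), ordered_norms N0 N1 ->
    forall (theta : R) (q : \bar R), 0 < theta < 1 -> (1 <= q)%E ->
    same_space (Kspace G N0 N1) (Kspace G N0 (real_interp N0 N1 theta q)).
  by move=> hR V N0 N1 hN theta q th hq; exact: sqrt_bounded_Kspace.
have th1 : 0 < (3^-1 : R) < 1 by rewrite invr_gt0 ltr0n invf_lt1 ?ltr0n// ltr1n.
have th2 : 0 < (2^-1 : R) < 1 by rewrite invr_gt0 ltr0n invf_lt1 ?ltr0n// ltr1n.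
have th12 : 3^-1 != 2^-1 :> R by rewrite (inj_eq invr_inj) eqr_nat.
have two (V : lmodType R) (N0 N1 : V -> \bar R) :
    (forall (theta : R) (q : \bar R), 0 < theta < 1 -> (1 <= q)%E ->
      same_space (Kspace G N0 N1) (Kspace G N0 (real_interp N0 N1 theta q))) ->
    exists (theta1 theta2 : R) (q1 q2 : \bar R),
      [/\ 0 < theta1 < 1, 0 < theta2 < 1, theta1 != theta2,
          (1 <= q1)%E & (1 <= q2)%E] /\
      same_space (Kspace G N0 (real_interp N0 N1 theta1 q1))
        (Kspace G N0 (real_interp N0 N1 theta2 q2)).
  move=> h; exists 3^-1, 2^-1, 1%E, 1%E.
  split; first by split; [exact: th1|exact: th2|exact: th12|exact: lexx|exact: lexx].
  have s1 := h 3^-1 1%E th1 (lexx _); have s2 := h 2^-1 1%E th2 (lexx _).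
  by apply: (same_space_trans _ _ (same_space_sym s1) s2) => x; exact: (Kspace_ge0 hB).
tfae.
- by move=> hR A oA theta q; apply: (ab hR); exact: ordered_banach_pair.
- by move=> hb A oA; apply: two => theta q; exact: hb.
- move=> hc; have [t1 [t2 [q1 [q2 [[h1 h2 h12 hq1 hq2] ss]]]]] :=
    hc _ (@ordered_bounded_pair R).
  apply: two => theta q; apply: ab; last exact: ordered_L1_Linfty.
  exact: (same_Kspace_sqrt_bounded hG (ordered_banach_pair (@ordered_bounded_pair R))
    realizing_bounded_pair h1 h2 h12 hq1 hq2 ss).
- move=> [t1 [t2 [q1 [q2 [[h1 h2 h12 hq1 hq2] ss]]]]].
  exact: (same_Kspace_sqrt_bounded hG ordered_L1_Linfty realizing_L1_Linfty
    h1 h2 h12 hq1 hq2 ss).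
Qed.
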